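(* Let $\mathcal{A}$ be a Banach algebra such that $\mathrm{rad}(\mathcal{A})=\mathrm{rann}(\mathcal{A})$ and $\mathcal{A}/\mathrm{rad}(\mathcal{A})$ is commutative. If $\mathcal{A}$ has a right identity, then every generalized derivation of $\mathcal{A}$ is spectrally bounded.
   Context: $\mathrm{rad}(\mathcal{A})$ is the Jacobson radical and $\mathrm{rann}(\mathcal{A})=\{c\in\mathcal{A}: ac=0\ \forall a\in\mathcal{A}\}$. A derivation is a linear map $d:\mathcal{A}\to\mathcal{A}$ with $d(ab)=d(a)b+ad(b)$. A generalized derivation of $\mathcal{A}$ is a linear map $\delta:\mathcal{A}\to\mathcal{A}$ for which there exists a derivation $d$ of $\mathcal{A}$ with $\delta(ab)=a\delta(b)+d(a)b$ for all $a,b\in\mathcal{A}$. A linear map $T:\mathcal{A}\to\mathcal{A}$ is spectrally bounded if there is $M\ge 0$ with $r(T(a))\le M\,r(a)$ for all $a\in\mathcal{A}$, where $r$ denotes spectral radius. *)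

(* Defs.v *)
From HB Require Import structures.
From mathcomp Require Import all_boot all_order all_algebra.
From mathcomp Require Import all_classical all_reals all_analysis.
From mathcomp Require Import complex.
Import Order.TTheory GRing.Theory Num.Theory.
Import numFieldNormedType.Exports.

Set Implicit Arguments.
Unset Strict Implicit.
Unset Printing Implicit Defensive.

Local Open Scope ring_scope.
Local Open Scope classical_set_scope.

Section BanachAlgebra.
Variable R : realType.
Variable A : completeNormedModType R[i].
Variable mul : A -> A -> A.

Definition banach_algebra_mul : Prop :=
  (forall a b c, mul a (mul b c) = mul (mul a b) c) /\
  [/\ (forall a b c, mul (a + b) c = mul a c + mul b c),
      (forall a b c, mul a (b + c) = mul a b + mul a c),
      (forall (k : R[i]) a b, mul (k *: a) b = k *: mul a b),
      (forall (k : R[i]) a b, mul a (k *: b) = k *: mul a b) &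
      (forall a b, `|mul a b| <= `|a| * `|b|)].

(* quasi-invertibility (x o y = x + y - x y); in the unitization this means
   that 1 - x is invertible *)
Definition quasi_invertible (x : A) : Prop :=
  exists y : A, x + y - mul x y = 0 /\ y + x - mul y x = 0.

(* spectrum of a (computed in the unitization when A is non-unital):
   lambda <> 0 is in the spectrum iff lambda - a is not invertible in the
   unitization iff lambda^-1 a is not quasi-invertible; 0 always belongs *)
Definition spectrum (a : A) : set R[i] :=
  [set l | l = 0 \/ ~ quasi_invertible (l^-1 *: a)].

Definition spectral_radius (a : A) : R :=
  sup [set ComplexField.Normc.normc l | l in spectrum a].

(* Jacobson radical: the elements a such that a b is quasi-invertible for
   every b in A (Jacobson's characterization for possibly non-unital
   algebras) *)
Definition jacobson_radical : set A :=
  [set a | forall b : A, quasi_invertible (mul a b)].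

Definition rann : set A := [set c | forall a : A, mul a c = 0].

Definition has_right_identity : Prop :=
  exists e : A, forall a : A, mul a e = a.

Definition quotient_by_rad_commutative : Prop :=
  forall a b : A, jacobson_radical (mul a b - mul b a).

Definition derivation (d : A -> A) : Prop :=
  linear d /\ forall a b, d (mul a b) = mul (d a) b + mul a (d b).

Definition generalized_derivation (delta : A -> A) : Prop :=
  linear delta /\
  exists d : A -> A, derivation d /\
    forall a b, delta (mul a b) = mul a (delta b) + mul (d a) b.

Definition spectrally_bounded (T : A -> A) : Prop :=
  linear T /\ exists M : R, 0 <= M /\
    forall a : A, spectral_radius (T a) <= M * spectral_radius a.

End BanachAlgebra.

(* Main.v *)
Require Import Defs.
From HB Require Import structures.
From mathcomp Require Import all_boot all_order all_algebra.
From mathcomp Require Import all_classical all_reals all_analysis.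
From mathcomp Require Import complex.
From mathcomp Require Import ring lra.
Import Order.TTheory GRing.Theory Num.Theory.
Import numFieldNormedType.Exports.
Local Open Scope ring_scope.
Local Open Scope classical_set_scope.

(* With [e] a right identity, [delta a = a delta(e) + d a].  The corner [e A]
   is a commutative semisimple Banach algebra isomorphic to [A / rad A], and [d]
   induces a derivation of it because [d] preserves [rann A].  By Johnson's
   theorem this derivation vanishes, so every character [phi] of [e A] satisfies
   [phi (delta a) = phi a * phi (delta e)]; as characters compute the nonzero
   spectrum, [r (delta a) <= M r a] with [M] a multiple of [|delta e|].

   Johnson's theorem.  A gliding hump shows that [phi \o d] is bounded for all
   but finitely many characters [phi]; a separating space of [d] supported on
   finitely many characters must vanish, so [d] is continuous by the closed
   graph theorem, and [n! (phi (d a))^n = phi (d^n (a^n))] for [phi a = 0] gives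
   [phi (d a) = 0].

   Characters.  A minimal submultiplicative seminorm is multiplicative, and
   Ostrowski's form of the Gelfand-Mazur theorem makes it the modulus of a
   character. *)

Set Implicit Arguments.
Unset Strict Implicit.
Unset Printing Implicit Defensive.

(** * The complex modulus with values in the reals *)

Section ComplexModulus.
Variable R : realType.
Implicit Types z w : R[i].

Local Notation nc := (@ComplexField.Normc.normc R).

Lemma normc_ge0 z : 0 <= nc z.
Proof. by case: z => a b; exact: sqrtr_ge0. Qed.

Lemma normc_opp z : nc (- z) = nc z.
Proof. exact: normcN. Qed.

Lemma normc_triangle z w : nc (z + w) <= nc z + nc w.
Proof. exact: le_normcD. Qed.

Lemma normc_0 : nc 0 = 0.
Proof. exact: ComplexField.Normc.normc0. Qed.

Lemma normc_1 : nc 1 = 1.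
Proof. exact: ComplexField.Normc.normc1. Qed.

Lemma normc_mul z w : nc (z * w) = nc z * nc w.
Proof. exact: ComplexField.Normc.normcM. Qed.

Lemma normc_inv z : nc z^-1 = (nc z)^-1.
Proof. exact: ComplexField.Normc.normcV. Qed.

Lemma normc_eq0 z : (nc z == 0) = (z == 0).
Proof.
by apply/eqP/eqP => [/ComplexField.Normc.eq0_normc|->]; rewrite ?normc_0.
Qed.

Lemma normc_gt0 z : (0 < nc z) = (z != 0).
Proof. by rewrite lt_neqAle normc_ge0 andbT eq_sym normc_eq0. Qed.

Lemma normcX z n : nc (z ^+ n) = nc z ^+ n.
Proof.
elim: n => [|n IH]; first by rewrite !expr0 normc_1.
by rewrite !exprS normc_mul IH.
Qed.

Lemma normc_real (r : R) : 0 <= r -> nc r%:C%C = r.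
Proof. by move=> r0; rewrite /= expr0n addr0 sqrtr_sqr ger0_norm. Qed.

Lemma normc_natr n : nc n%:R = n%:R.
Proof. by rewrite -(@normc_real n%:R) ?ler0n// rmorph_nat. Qed.

Lemma norm_normc z : `|z| = (nc z)%:C%C.
Proof. by []. Qed.

End ComplexModulus.

(** * Submultiplicative seminorms: minimal ones exist and are multiplicative *)

Section AlgebraSeminorms.
Variables (R : realType) (B : comAlgType R[i]).
Implicit Types (x y z : B) (k l : R[i]) (p q : B -> R).

Local Notation nc := (@ComplexField.Normc.normc R).

Record submult_seminorm p : Prop := SubmultSeminorm {
  snZ : forall k x, p (k *: x) = nc k * p x;
  snD : forall x y, p (x + y) <= p x + p y;
  snM : forall x y, p (x * y) <= p x * p y }.

Section Basics.
Variable p : B -> R.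
Hypothesis sp : submult_seminorm p.

Lemma sn0 : p 0 = 0.
Proof. by rewrite -(scale0r (0 : B)) (snZ sp) normc_0 mul0r. Qed.

Lemma snN x : p (- x) = p x.
Proof. by rewrite -scaleN1r (snZ sp) normc_opp normc_1 mul1r. Qed.

Lemma sn_ge0 x : 0 <= p x.
Proof. by have := snD sp x (- x); rewrite subrr sn0 snN; lra. Qed.

Lemma snB x y : p (x - y) <= p x + p y.
Proof. by rewrite -(snN y); exact: (snD sp). Qed.

Lemma sn_subC x y : p (x - y) = p (y - x).
Proof. by rewrite -snN opprB. Qed.

Lemma sn_sum (I : Type) (r : seq I) (P : pred I) (F : I -> B) :
  p (\sum_(i <- r | P i) F i) <= \sum_(i <- r | P i) p (F i).
Proof.
elim/big_ind2 : _ => [|x a y b xa yb|//]; first by rewrite sn0.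
by apply: le_trans (snD sp _ _) _; exact: lerD.
Qed.

Lemma snMn x n : p (x *+ n) = p x *+ n.
Proof. by rewrite -scaler_nat (snZ sp) normc_natr mulr_natl. Qed.

Lemma snX x n : p (x ^+ n) <= p 1 * p x ^+ n.
Proof.
elim: n => [|n IH]; first by rewrite !expr0 mulr1.
rewrite !exprSr mulrA; apply: le_trans (snM sp _ _) _.
by rewrite ler_wpM2r// sn_ge0.
Qed.

Lemma sn1_ge1 : 0 < p 1 -> 1 <= p 1.
Proof. by move=> p1; have := snM sp 1 1; rewrite mul1r ler_pMr. Qed.

End Basics.

(* [S x s] is to be read as: [s] is an admissible bound for [x]. *)
Lemma inf_bounds_seminorm (S : B -> R -> Prop) :
  (forall x, exists s, S x s) -> (forall x s, S x s -> 0 <= s) ->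
  (forall k x s, S x s -> S (k *: x) (nc k * s)) ->
  (forall x y s t, S x s -> S y t -> exists2 u, S (x + y) u & u <= s + t) ->
  (forall x y s t, S x s -> S y t -> exists2 u, S (x * y) u & u <= s * t) ->
  submult_seminorm (fun x => inf [set s | S x s]).
Proof.
move=> S0 Sge SZ SD SM.
have hi x : has_inf [set s | S x s].
  by split; [have [s] := S0 x; exists s | exists 0 => s /Sge].
have lei x s : S x s -> inf [set s | S x s] <= s by move=> ?; apply: ge_inf => //; case: (hi x).
have gei x t : (forall s, S x s -> t <= s) -> t <= inf [set s | S x s].
  by move=> H; apply: lb_le_inf => //; case: (hi x).
have adh x e : 0 < e -> exists2 s, S x s & s < inf [set s | S x s] + e.
  by move=> e0; exact: inf_adherent e0 (hi x).
have ige0 x : 0 <= inf [set s | S x s] by apply: gei; exact: Sge.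
have leZ k x : inf [set s | S (k *: x) s] <= nc k * inf [set s | S x s].
  have [->|k0] := eqVneq k 0.
    rewrite normc_0 mul0r; have [s /(SZ 0)] := S0 x.
    by rewrite normc_0 mul0r => /lei.
  rewrite -ler_pdivrMl ?normc_gt0//; apply: gei => s Ss.
  by rewrite ler_pdivrMl ?normc_gt0//; apply: lei; exact: SZ.
split=> [k x|x y|x y].
- apply/eqP; rewrite eq_le leZ /=.
  have [->|k0] := eqVneq k 0; first by rewrite normc_0 mul0r ige0.
  have := leZ k^-1 (k *: x); rewrite scalerA mulVf// scale1r normc_inv.
  by rewrite -ler_pdivrMl ?invr_gt0 ?normc_gt0// invrK.
- apply/ler_addgt0Pr => e e0.
  have e2 : 0 < e / 2 by lra.
  have [s Ss sl] := adh x _ e2; have [t St tl] := adh y _ e2.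
  by have [u /lei Su ul] := SD _ _ _ _ Ss St; lra.
(* The infimum is taken over one factor at a time; a zero factor is treated apart because the
   argument divides by it. *)
- have key s t : S x s -> S y t -> inf [set s | S (x * y) s] <= s * t.
    by move=> Ss St; have [u /lei Su ul] := SM _ _ _ _ Ss St; exact: le_trans ul.
  have key2 t : S y t -> inf [set s | S (x * y) s] <= inf [set s | S x s] * t.
    move=> St; have := Sge _ _ St; rewrite le_eqVlt => /predU1P[t0|t0].
      have [s Ss] := S0 x.
      by have := key _ _ Ss St; rewrite -t0 !mulr0.
    rewrite -ler_pdivrMr//; apply: gei => s Ss; rewrite ler_pdivrMr//.
    exact: key.
  have := ige0 x; rewrite le_eqVlt => /predU1P[t0|t0].
    by have [t /key2] := S0 y; rewrite -t0 !mul0r.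
  rewrite -ler_pdivrMl//; apply: gei => s Ss; rewrite ler_pdivrMl//.
  exact: key2.
Qed.

Lemma inf_bounds_le (S : B -> R -> Prop) x s :
  (forall x s, S x s -> 0 <= s) -> S x s -> inf [set s | S x s] <= s.
Proof. by move=> Sge Ss; apply: ge_inf => //; exists 0 => t /Sge. Qed.

Lemma inf_bounds_ge (S : B -> R -> Prop) x t :
  (forall x, exists s, S x s) -> (forall s, S x s -> t <= s) ->
  t <= inf [set s | S x s].
Proof. by move=> S0 H; apply: lb_le_inf => //; have [s] := S0 x; exists s. Qed.

Definition minimal_seminorm p :=
  [/\ submult_seminorm p, 1 <= p 1 &
    forall q, submult_seminorm q -> 1 <= q 1 -> (forall x, q x <= p x) ->
      forall x, p x <= q x].

(** Zorn's lemma for the reversed pointwise order. The infimum of a chain is again a seminorm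
    because, of two members of a chain, the smaller one controls both sums and products. *)
Lemma exists_minimal_seminorm q : submult_seminorm q -> 1 <= q 1 ->
  exists2 p, minimal_seminorm p & forall x, p x <= q x.
Proof.
move=> sq q1.
pose T := {p : B -> R | submult_seminorm p /\ 1 <= p 1 /\ forall x, p x <= q x}.
have t0 : T := exist _ q (conj sq (conj q1 (fun x => lexx (q x)))).
have [||A tot|[p [sp [p1 pq]]] pmin] := @ZL_preorder T t0
    (fun r s : T => `[< forall x, sval s x <= sval r x >]).
- by move=> t; apply/asboolP.
- move=> r s t /asboolP rs /asboolP st; apply/asboolP => x.
  exact: le_trans (st x) (rs x).
- have [[a Aa]|nA] := pselect (exists a, A a); last first.
    (* The empty chain is bounded by [q] itself. *)
    by exists t0 => s As; exfalso; apply: nA; exists s.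
  pose S x s := exists2 a, A a & s = sval a x.
  have S0 x : exists s, S x s by exists (sval a x), a.
  have Sge x s : S x s -> 0 <= s.
    by move=> [[b [sb ?]] _ ->]; exact: sn_ge0.
  have sS : submult_seminorm (fun x => inf [set s | S x s]).
    apply: inf_bounds_seminorm => //.
    + move=> k x _ [b Ab ->]; exists b => //.
      by case: b Ab => b [sb ?] _ /=; rewrite (snZ sb).
    + move=> x y _ _ [b Ab ->] [c Ac ->].
      have [sb _] := svalP b; have [sc _] := svalP c.
      have [/asboolP bc|/asboolP cb] := tot _ _ Ab Ac.
        exists (sval c (x + y)); first by exists c.
        by apply: le_trans (snD sc _ _) _; rewrite lerD2r.
      exists (sval b (x + y)); first by exists b.
      by apply: le_trans (snD sb _ _) _; rewrite lerD2l.
    + move=> x y _ _ [b Ab ->] [c Ac ->].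
      have [sb _] := svalP b; have [sc _] := svalP c.
      have [/asboolP bc|/asboolP cb] := tot _ _ Ab Ac.
        exists (sval c (x * y)); first by exists c.
        by apply: le_trans (snM sc _ _) _; rewrite ler_wpM2r// (sn_ge0 sc).
      exists (sval b (x * y)); first by exists b.
      by apply: le_trans (snM sb _ _) _; rewrite ler_wpM2l// (sn_ge0 sb).
  have S1 : 1 <= inf [set s | S 1 s].
    by apply: inf_bounds_ge => // s [[b [sb [b1 ?]]] _ ->].
  have Sq x : inf [set s | S x s] <= q x.
    apply: (@le_trans _ _ (sval a x)); last by case: (svalP a) => _ [].
    by apply: inf_bounds_le => //; exists a.
  pose t : T := exist _ (fun x => inf [set s | S x s]) (conj sS (conj S1 Sq)).
  exists t => s As; apply/asboolP => x /=.
  by apply: inf_bounds_le => //; exists s.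
exists p => //; split=> // q' sq' q'1 q'p.
have q'q x : q' x <= q x by exact: le_trans (q'p x) (pq x).
pose t : T := exist _ q' (conj sq' (conj q'1 q'q)).
by have /asboolP := pmin t (asboolT q'p).
Qed.

Section Minimal.
Variable p : B -> R.
Hypothesis mp : minimal_seminorm p.

Let sp : submult_seminorm p. Proof. by case: mp. Qed.
Let p1 : 1 <= p 1. Proof. by case: mp. Qed.
Let pge0 := sn_ge0 sp.

(* The spectral seminorm of [p] is again an admissible competitor. *)
Lemma minimal_le_geometric x (s C : R) : 0 <= s ->
  (forall n, p (x ^+ n) <= C * s ^+ n) -> p x <= s.
Proof.
move=> s0 xs; have [_ _ pmin] := mp.
pose S x s := 0 <= s /\ exists C, forall n, p (x ^+ n) <= C * s ^+ n.
have S0 y : exists s, S y s by exists (p y); split => //; exists (p 1) => n; exact: snX.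
have Sge y t : S y t -> 0 <= t by case.
have Cge0 y t C' : (forall n, p (y ^+ n) <= C' * t ^+ n) -> 0 <= C'.
  by move=> /(_ 0%N); rewrite !expr0 mulr1; apply: le_trans.
suff: p x <= inf [set s | S x s].
  by move=> /le_trans; apply; apply: inf_bounds_le => //; split => //; exists C.
apply: (pmin (fun y => inf [set s | S y s])).
- apply: inf_bounds_seminorm => //.
  + move=> k y t [t0 [C' H]]; split; first by rewrite mulr_ge0 ?normc_ge0.
    exists C' => n; rewrite exprZn (snZ sp) normcX exprMn mulrCA.
    by rewrite ler_wpM2l ?exprn_ge0 ?normc_ge0.
  + move=> y z t u [t0 [C1 H1]] [u0 [C2 H2]]; exists (t + u) => //.
    split; first by rewrite addr_ge0.
    (* The binomial theorem, hence commutativity of [B], makes the growth rate subadditive. *)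
    exists (C1 * C2) => n; rewrite !exprDn mulr_sumr.
    apply: le_trans (sn_sum sp _ _ _) _; apply: ler_sum => i _.
    rewrite (snMn sp) mulrnAr; rewrite lerMn2r; apply/orP; right.
    rewrite (le_trans (snM sp _ _))// mulrACA; exact: ler_pM.
  + move=> y z t u [t0 [C1 H1]] [u0 [C2 H2]]; exists (t * u) => //.
    split; first by rewrite mulr_ge0.
    exists (C1 * C2) => n; rewrite !exprMn mulrACA (le_trans (snM sp _ _))//.
    exact: ler_pM.
(* A rate [t < 1] at [1] would give [p 1 <= C' * t ^+ n] for all [n], against [1 <= p 1]. *)
- apply: inf_bounds_ge => // t [t0 [C' H]]; rewrite leNgt; apply/negP => t1.
  have C0 : 0 < C'.
    have := H 0%N; rewrite !expr0 mulr1; exact/lt_le_trans/lt_le_trans.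
  have : t < 1 by [].
  have /cvgrPdist_lt/(_ C'^-1) : (fun n => t ^+ n) @ \oo --> 0.
    by apply: cvg_expr; rewrite ger0_norm.
  rewrite invr_gt0 => /(_ C0)[n _ /(_ n (leqnn n))/=].
  rewrite sub0r normrN ger0_norm ?exprn_ge0// => tn _.
  have Ctn : C' * t ^+ n < 1 by rewrite -ltr_pdivlMl// mulr1.
  by have := H n; rewrite expr1n => pC; have := le_lt_trans (le_trans p1 pC) Ctn; rewrite ltxx.
- move=> y; apply: inf_bounds_le => //; split=> //; exists (p 1) => n; exact: snX.
Qed.

Lemma minimal_at1 : p 1 = 1.
Proof.
apply/eqP; rewrite eq_le p1 andbT.
by apply: (@minimal_le_geometric 1 1 (p 1)) => // n; rewrite !expr1n mulr1.
Qed.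

(** If [p (x ^+ 2)] were smaller, some [s < p x] would bound the growth of the even powers, and of
    all powers up to a constant, contradicting [minimal_le_geometric]. *)
Lemma minimal_sqr x : p (x ^+ 2) = p x ^+ 2.
Proof.
apply/eqP; rewrite eq_le; apply/andP; split; first by rewrite !expr2; exact: snM.
rewrite leNgt; apply/negP => lt2.
have px : 0 < p x.
  by rewrite lt_neqAle pge0 andbT; apply: contraTneq lt2 => <-; rewrite expr0n /= -leNgt.
(* The entry [p x / 2] only keeps [s] positive when [p (x ^+ 2) = 0]. *)
pose s := Num.max (Num.sqrt (p (x ^+ 2))) (p x / 2).
have sx : s < p x.
  rewrite gt_max ltr_pdivrMr// ltr_pMr// ltr1n andbT.
  by rewrite -(ger0_norm (pge0 x)) -sqrtr_sqr ltr_sqrt// exprn_gt0.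
have s0 : 0 < s by rewrite lt_max orbC divr_gt0.
have s2 : p (x ^+ 2) <= s ^+ 2.
  rewrite -[leLHS]sqr_sqrtr// ler_sqr ?nnegrE ?sqrtr_ge0 ?(ltW s0)//.
  by rewrite le_max lexx.
suff : p x <= s by rewrite leNgt sx.
have even n : p (x ^+ (n * 2)) <= s ^+ (n * 2).
  rewrite mulnC !exprM; apply: le_trans (snX sp _ _) _.
  by rewrite minimal_at1 mul1r lerXn2r ?nnegrE// exprn_ge0// ltW.
(* The summand [p x / s] pays for the extra factor [x] of an odd power. *)
apply: (@minimal_le_geometric x s (1 + p x / s)) => [|n]; first exact: ltW.
rewrite -(odd_double_half n) -muln2; case: (odd n) => /=.
  rewrite add1n !exprS; apply: le_trans (snM sp _ _) _.
  rewrite mulrA mulrDl mul1r divfK ?gt_eqF// ler_pM// lerDr; exact: ltW.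
rewrite add0n (le_trans (even _))// ler_pMl ?exprn_gt0//.
by rewrite lerDl divr_ge0// ltW.
Qed.

(** Equality holds for exponents [2 ^ n] by repeated squaring; splitting such a power as
    [x ^+ (2 ^ n - n) * x ^+ n] then leaves no room for strict inequality at [n]. *)
Lemma minimalX x n : p (x ^+ n) = p x ^+ n.
Proof.
have le m : p (x ^+ m) <= p x ^+ m by have := snX sp x m; rewrite minimal_at1 mul1r.
have pow2 j : p (x ^+ (2 ^ j)) = p x ^+ (2 ^ j).
  elim: j => [|j IH]; first by rewrite expn0 !expr1.
  by rewrite expnSr !exprM minimal_sqr IH.
apply/eqP; rewrite eq_le le /=.
have [->|px] := eqVneq (p x) 0.
  by rewrite expr0n; case: n => [|n]; rewrite ?expr0 ?minimal_at1 ?pge0.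
have px0 : 0 < p x by rewrite lt_neqAle eq_sym px pge0.
have nk : (n <= 2 ^ n)%N by rewrite ltnW// ltn_expl.
have := pow2 n; rewrite -(subnK nk) !exprD => e.
rewrite -(ler_pM2l (exprn_gt0 (2 ^ n - n) px0)) -e.
apply: le_trans (snM sp _ _) _; rewrite ler_wpM2r//.
Qed.

(** For [p x != 0] the competitor is the infimum over [n] of [p (x ^+ n * z) / p x ^+ n]. It is
    subadditive because these quotients decrease with [n], and [minimalX] controls its value at [1].
    Minimality compares [p y] with the quotient for [n = 1]. *)
Lemma minimalM x y : p (x * y) = p x * p y.
Proof.
apply/eqP; rewrite eq_le (snM sp) /=.
have [->|px] := eqVneq (p x) 0; first by rewrite mul0r.
have px0 : 0 < p x by rewrite lt_neqAle eq_sym px pge0.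
have [_ _ pmin] := mp.
pose S z s := exists n, s = p (x ^+ n * z) / p x ^+ n.
have S0 z : exists s, S z s by exists (p (x ^+ 0 * z) / p x ^+ 0), 0%N.
have Sge z s : S z s -> 0 <= s by move=> [n ->]; rewrite divr_ge0// exprn_ge0// ltW.
suff : p y <= inf [set s | S y s].
  rewrite mulrC -ler_pdivlMr// => /le_trans; apply; apply: inf_bounds_le => //.
  by exists 1%N; rewrite !expr1.
have dec n m z : p (x ^+ (n + m) * z) / p x ^+ (n + m) <= p (x ^+ n * z) / p x ^+ n.
  rewrite addnC !exprD ler_pdivrMr ?mulr_gt0 ?exprn_gt0// [p x ^+ m * _]mulrC.
  by rewrite mulrA divfK ?gt_eqF ?exprn_gt0// -mulrA -minimalX mulrC; exact: snM.
apply: (pmin (fun z => inf [set s | S z s])); last 1 first.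
- by move=> z; apply: inf_bounds_le => //; exists 0%N; rewrite !expr0 divr1 mul1r.
- apply: inf_bounds_seminorm => //.
  + by move=> k z _ [n ->]; exists n; rewrite -(scalerAr k) (snZ sp) mulrA.
  + move=> u z _ _ [n ->] [m ->].
    exists (p (x ^+ (n + m) * (u + z)) / p x ^+ (n + m)); first by exists (n + m)%N.
    apply: (le_trans _ (lerD (dec n m u) (dec m n z))).
    rewrite (addnC m) -mulrDl ler_wpM2r ?invr_ge0 ?exprn_ge0//.
    by rewrite mulrDr; exact: snD.
  + move=> u z _ _ [n ->] [m ->].
    exists (p (x ^+ (n + m) * (u * z)) / p x ^+ (n + m)); first by exists (n + m)%N.
    rewrite mulrACA -invfM -exprD ler_wpM2r ?invr_ge0 ?exprn_ge0//.
    by rewrite exprD mulrACA; exact: snM.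
- apply: inf_bounds_ge => // s [n ->].
  by rewrite mulr1 minimalX divff// expf_neq0.
Qed.

End Minimal.
End AlgebraSeminorms.

(** * Limits of real and complex sequences at a geometric rate *)

Section Limits.
Variable R : realType.

Lemma half_expr_small (e : R) : 0 < e -> exists n, 2^-1 ^+ n < e.
Proof.
move=> e0; have /cvgrPdist_lt/(_ _ e0)[n _ /(_ n (leqnn n))/=] :
    (fun n => (2^-1 : R) ^+ n) @ \oo --> 0.
  by apply: cvg_expr; rewrite ger0_norm ?invr_ge0// invf_lt1// ltr1n.
by rewrite sub0r normrN ger0_norm ?exprn_ge0 ?invr_ge0// => ?; exists n.
Qed.

Lemma le0_half_expr (a C : R) : (forall n, a <= C * 2^-1 ^+ n) -> a <= 0.
Proof.
move=> H; rewrite leNgt; apply/negP => a0.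
have C0 : 0 < C by have := H 0%N; rewrite expr0 mulr1; exact: lt_le_trans.
have [n] := half_expr_small (divr_gt0 a0 C0).
by rewrite ltr_pdivlMr// mulrC ltNge H.
Qed.

(** The limit is the supremum of the lower estimates [r n - 2^-1 ^+ n], all of which lie below every
    upper estimate [r k + 2^-1 ^+ k]. *)
Lemma fast_cauchy_real (r : nat -> R) :
  (forall n k, r n - r k <= 2^-1 ^+ n + 2^-1 ^+ k) ->
  exists a, forall n, `|a - r n| <= 2^-1 ^+ n.
Proof.
move=> H; pose E := [set r n - 2^-1 ^+ n | n in setT].
have hub k : ubound E (r k + 2^-1 ^+ k) by move=> _ [n _ <-]; have := H n k; lra.
exists (sup E) => n; rewrite ler_norml; apply/andP; split.
  have : r n - 2^-1 ^+ n <= sup E; last by lra.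
  by apply: ub_le_sup; [exists (r 0%N + 2^-1 ^+ 0)|exists n].
suff : sup E <= r n + 2^-1 ^+ n by lra.
by apply: ge_sup; [exists (r n - 2^-1 ^+ n), n|exact: hub].
Qed.

Lemma fast_cauchy_complex (l : nat -> R[i]) :
  (forall n k, ComplexField.Normc.normc (l n - l k) <= 2^-1 ^+ n + 2^-1 ^+ k) ->
  exists z, forall n, ComplexField.Normc.normc (z - l n) <= 2 * 2^-1 ^+ n.
Proof.
move=> H.
have hRe (z : R[i]) : `|complex.Re z| <= ComplexField.Normc.normc z.
  by have := normc_ge_Re z; rewrite lecR.
have hIm (z : R[i]) : `|complex.Im z| <= ComplexField.Normc.normc z.
  by case: z => a b /=; rewrite -sqrtr_sqr ler_wsqrtr// lerDr sqr_ge0.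
have [|a ha] := @fast_cauchy_real (fun n => complex.Re (l n)).
  move=> n k; rewrite -raddfB; apply: le_trans (ler_norm _) _.
  exact: le_trans (hRe _) (H n k).
have [|b hb] := @fast_cauchy_real (fun n => complex.Im (l n)).
  move=> n k; rewrite -raddfB; apply: le_trans (ler_norm _) _.
  exact: le_trans (hIm _) (H n k).
exists (a +i* b)%C => n; have := ha n; have := hb n.
case: (l n) => u v /= hv hu.
have -> : 2 * (2^-1 : R) ^+ n = 2^-1 ^+ n + 2^-1 ^+ n by lra.
have tn : 0 <= (2^-1 : R) ^+ n by rewrite exprn_ge0// invr_ge0.
rewrite -[leRHS]ger0_norm ?addr_ge0// -sqrtr_sqr ler_wsqrtr//.
move: hu hv; rewrite -!(ler_sqr (normr_ge0 _)) ?nnegrE// !real_normK ?num_real//.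
by move: (_ ^+ n) tn => t t0; nra.
Qed.

End Limits.

(** * Gelfand-Mazur by Ostrowski's argument: every element is a scalar modulo [p] *)

Section Ostrowski.
Variables (R : realType) (B : comAlgType R[i]) (p : B -> R).
Hypothesis mp : minimal_seminorm p.

Local Notation nc := (@ComplexField.Normc.normc R).
Let sp : submult_seminorm p. Proof. by case: mp. Qed.

Lemma minimal_scalar (k : R[i]) : p k%:A = nc k.
Proof. by rewrite (snZ sp) (minimal_at1 mp) mulr1. Qed.

Lemma minimal_prod (s : seq R[i]) (x : B) :
  p (\prod_(z <- s) (x - z%:A)) = \prod_(z <- s) p (x - z%:A).
Proof.
elim: s => [|z s IH]; first by rewrite !big_nil (minimal_at1 mp).
by rewrite !big_cons (minimalM mp) IH.
Qed.

(* [X^n.+1 - c^n.+1] is [X - c] times a product of [n] linear factors. *)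
Lemma minimal_subrXX (m : R) (x : B) (c : R[i]) (n : nat) : 0 <= m ->
  (forall l, m <= p (x - l%:A)) ->
  p (x - c%:A) * m ^+ n <= p x ^+ n.+1 + nc c ^+ n.+1.
Proof.
move=> m0 H.
pose Q := \sum_(i < n.+1) 'X ^+ (n.+1.-1 - i) * c%:P ^+ i : {poly R[i]}.
have e : 'X ^+ n.+1 - c%:P ^+ n.+1 = ('X - c%:P) * Q by exact: subrXX.
have mQ : Q \is monic.
  rewrite -(monicMl _ (monicXsubC c)) -e -rmorphXn.
  by rewrite monicXnsubC.
have sQ : size Q = n.+1.
  have := size_Mmonic (monic_neq0 (monicXsubC c)) mQ.
  by rewrite -e -rmorphXn size_XnsubC// size_XsubC => -[].
have [s Es] := closed_field_poly_normal Q.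
move: Es; rewrite (monicP mQ) scale1r => Es.
have ss : size s = n by move: sQ; rewrite Es size_prod_XsubC => -[].
have : p (horner_alg x ('X ^+ n.+1 - c%:P ^+ n.+1)) = p (x - c%:A) * \prod_(z <- s) p (x - z%:A).
  rewrite e Es rmorphM rmorphB /= horner_algX horner_algC rmorph_prod /=.
  rewrite (minimalM mp) -minimal_prod; congr (_ * p _).
  by apply: eq_bigr => z _; rewrite rmorphB /= horner_algX horner_algC.
rewrite rmorphB !rmorphXn /= horner_algX horner_algC => e2.
have ge : m ^+ n <= \prod_(z <- s) p (x - z%:A).
  rewrite -ss; elim: (s) => [|z t IH]; first by rewrite big_nil expr0.
  by rewrite big_cons /= exprS ler_pM// exprn_ge0.
apply: le_trans (ler_wpM2l (sn_ge0 sp _) ge) _; rewrite -e2.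
by apply: le_trans (snB sp _ _) _; rewrite !(minimalX mp) minimal_scalar.
Qed.

Lemma near_one_expr (n : nat) (e : R) : 0 < e ->
  exists2 d : R, 0 < d <= 1 & (1 + d) ^+ n <= 1 + e.
Proof.
move=> e0.
(* A crude Bernoulli bound; [3] absorbs the linear and the quadratic term in [d] at each step. *)
have bern (d : R) : 0 <= d -> d <= 1 -> (1 + d) ^+ n <= 1 + 3 ^+ n * d.
  move=> d0 d1; elim: n => [|n IH]; first by rewrite !expr0; lra.
  rewrite !exprSr; apply: le_trans (ler_wpM2r _ IH) _; first by lra.
  have : 1 <= (3 : R) ^+ n by rewrite exprn_ege1// ler1n.
  move: (3 ^+ n) => t t1.
  have h1 : d <= t * d by rewrite ler_peMl.
  have h2 : t * d * d <= t * d by rewrite ler_piMr// mulr_ge0// (le_trans ler01).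
  by lra.
have d0 : 0 < Num.min 1 (e / 3 ^+ n) by rewrite lt_min ltr01 divr_gt0 ?exprn_gt0.
have d1 : Num.min 1 (e / 3 ^+ n) <= 1 by rewrite ge_min lexx.
exists (Num.min 1 (e / 3 ^+ n)); first by rewrite d0.
apply: le_trans (bern _ (ltW d0) d1) _.
by rewrite lerD2l mulrC -ler_pdivlMr ?exprn_gt0// ge_min lexx orbT.
Qed.

(* Ostrowski's argument: an almost minimal value [p (x - l)] propagates to all
   points at distance at most [m / 2], hence by iteration arbitrarily far,
   where [p (x - l)] is large. *)
Lemma minimal_step (m : R) (x : B) (e : R) : 0 < m ->
  (forall l, m <= p (x - l%:A)) -> 0 < e ->
  exists2 d : R, 0 < d <= 1 & forall l c, nc c <= m / 2 ->
    p (x - l%:A) <= m * (1 + d) -> p (x - (l + c)%:A) <= m * (1 + e).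
Proof.
move=> m0 H e0; have e2 : 0 < e / 2 by lra.
have [n hn] := half_expr_small e2.
have [d d01 hd] := near_one_expr n.+1 e2; exists d => // l c cm xl.
have H' k : m <= p (x - l%:A - k%:A) by rewrite -addrA -opprD -scalerDl.
have := @minimal_subrXX m _ c n (ltW m0) H'.
rewrite -addrA -opprD -scalerDl => h.
have d0 : 0 <= d by case/andP: d01 => /ltW.
have h1 : p (x - l%:A) ^+ n.+1 <= m ^+ n.+1 * (1 + e / 2).
  apply: (@le_trans _ _ ((m * (1 + d)) ^+ n.+1)).
    by rewrite lerXn2r ?nnegrE ?(sn_ge0 sp)// mulr_ge0 ?(ltW m0)// addr_ge0.
  by rewrite exprMn ler_wpM2l// exprn_ge0// ltW.
have h2 : nc c ^+ n.+1 <= m ^+ n.+1 * (e / 2).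
  apply: (@le_trans _ _ ((m / 2) ^+ n.+1)).
    by rewrite lerXn2r ?nnegrE ?normc_ge0// divr_ge0// ltW.
  rewrite exprMn ler_wpM2l ?exprn_ge0 ?(ltW m0)// (le_trans _ (ltW hn))//.
  by rewrite exprS ler_piMl ?exprn_ge0 ?invr_ge0// invf_le1// ler1n.
rewrite -(ler_pM2r (exprn_gt0 n m0)); apply: (le_trans h).
apply: (le_trans (lerD h1 h2)).
by rewrite -mulrDr exprSr; move: (m ^+ n) => t; lra.
Qed.

(** Tolerances are chosen backwards: the last step must end within [e], and each earlier one within
    what its successor demands. *)
Lemma minimal_steps (m : R) (x : B) (k : nat) (e : R) : 0 < m ->
  (forall l, m <= p (x - l%:A)) -> 0 < e ->
  exists2 d : R, 0 < d <= 1 & forall l c, nc c <= m / 2 ->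
    p (x - l%:A) <= m * (1 + d) -> p (x - (l + c *+ k)%:A) <= m * (1 + e).
Proof.
move=> m0 H; elim: k e => [|k IH] e e0.
  exists (Num.min 1 e); first by rewrite lt_min ltr01 e0 ge_min lexx.
  move=> l c _ /le_trans; rewrite mulr0n addr0; apply.
  by rewrite ler_pM2l// lerD2l ge_min lexx orbT.
have [d /andP[d0 _] hd] := minimal_step m0 H e0; have [d' d'01 hd'] := IH _ d0.
by exists d' => // l c cm xl; rewrite mulrSr addrA; apply: hd => //; exact: hd'.
Qed.

Lemma minimal_eigenvalue (x : B) : exists l : R[i], p (x - l%:A) = 0.
Proof.
apply: contrapT => N0.
pose E := [set t | exists l : R[i], t = p (x - l%:A)].
have hE : has_inf E.
  split; first by exists (p (x - 0%:A)), 0.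
  by exists 0 => _ [l ->]; exact: sn_ge0.
pose m := inf E.
have H l : m <= p (x - l%:A) by apply: ge_inf; [case: hE|exists l].
have m0 : 0 <= m by apply: lb_le_inf; [case: hE|move=> _ [l ->]; exact: sn_ge0].
(* If [m = 0], a minimizing sequence of scalars is Cauchy because [p] is the modulus on scalars, and
   its limit attains the infimum. *)
have [m0'|] := ltP 0 m; last first.
  move=> mle; have {}m0 : m = 0 by apply/eqP; rewrite eq_le mle.
  have [l hl] : {l : nat -> R[i] & forall n, p (x - (l n)%:A) < 2^-1 ^+ n}.
    apply: (@choice _ _ (fun n l => p (x - l%:A) < 2^-1 ^+ n)) => n.
    have h0 : 0 < (2^-1 : R) ^+ n by rewrite exprn_gt0// invr_gt0.
    have [_ [l ->]] := inf_adherent h0 hE.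
    by rewrite -/m m0 add0r; exists l.
  have [|z hz] := @fast_cauchy_complex R l.
    move=> n k; rewrite -minimal_scalar.
    have -> : (l n - l k)%:A = (x - (l k)%:A) - (x - (l n)%:A) :> B.
      by rewrite scalerBl; ring.
    by apply: le_trans (snB sp _ _) _; rewrite addrC; apply: lerD; exact: ltW.
  exfalso; apply: N0; exists z; apply/eqP; rewrite eq_le (sn_ge0 sp) andbT.
  apply: (@le0_half_expr _ _ 3) => n.
  have -> : x - z%:A = (x - (l n)%:A) - (z - l n)%:A.
    by rewrite scalerBl; ring.
  apply: le_trans (snB sp _ _) _; rewrite minimal_scalar.
  by have := hl n; have := hz n; lra.
(* Eight steps of length [m / 2] cover the distance [4 * m], while [p] is strictly below [2 * m] at
   the start and at most [2 * m] at the end: the triangle inequality fails. *)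
have [d /andP[d0 d1] hd] := minimal_steps 8 m0' H (ltr01 : 0 < 1 :> R).
have := inf_adherent (mulr_gt0 m0' d0) hE => -[_ [l ->]]; rewrite -/m => lt.
pose c : R[i] := (m / 2)%:C%C.
have cm : nc c <= m / 2 by rewrite normc_real// divr_ge0.
have lt' : p (x - l%:A) <= m * (1 + d) by rewrite mulrDr mulr1 ltW.
have h8 := hd _ _ cm lt'.
have : nc (c *+ 8) <= p (x - l%:A) + p (x - (l + c *+ 8)%:A).
  rewrite -minimal_scalar; apply: le_trans (snB sp _ _).
  have -> : (c *+ 8)%:A = (x - l%:A) - (x - (l + c *+ 8)%:A).
    by rewrite (scalerDl _ l); ring.
  by [].
have -> : nc (c *+ 8) = 8 * (m / 2).
  by rewrite -(mulr_natl c) normc_mul normc_natr normc_real ?divr_ge0.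
have : m * d <= m by rewrite ler_piMr.
lra.
Qed.

End Ostrowski.

(** * Characters of a commutative Banach algebra *)

Section Characters.
Variables (R : realType) (B : comAlgType R[i]).
Implicit Types (x y : B) (phi : B -> R[i]).

Local Notation nc := (@ComplexField.Normc.normc R).

(* Completeness is only ever used for series dominated by a geometric one. *)
Record complete_algebra_norm (N : B -> R) : Prop := CompleteAlgebraNorm {
  can_sn : submult_seminorm N;
  can_eq0 : forall x, N x = 0 -> x = 0;
  can_lim : forall u : nat -> B, (forall n, N (u n) <= 2^-1 ^+ n) ->
    exists s, forall n, N (s - \sum_(i < n) u i) <= 2 * 2^-1 ^+ n }.

Record character phi : Prop := Character {
  ch1 : phi 1 = 1;
  chM : forall x y, phi (x * y) = phi x * phi y;
  chD : forall x y, phi (x + y) = phi x + phi y;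
  chZ : forall k x, phi (k *: x) = k * phi x }.

Section Basics.
Variable phi : B -> R[i].
Hypothesis cphi : character phi.

Lemma ch0 : phi 0 = 0.
Proof. by rewrite -(scale0r (0 : B)) (chZ cphi) mul0r. Qed.

Lemma chN x : phi (- x) = - phi x.
Proof. by rewrite -scaleN1r (chZ cphi) mulN1r. Qed.

Lemma chB x y : phi (x - y) = phi x - phi y.
Proof. by rewrite (chD cphi) chN. Qed.

Lemma ch_scalar k : phi k%:A = k.
Proof. by rewrite (chZ cphi) (ch1 cphi) mulr1. Qed.

Lemma chX x n : phi (x ^+ n) = phi x ^+ n.
Proof.
elim: n => [|n IH]; first by rewrite !expr0 (ch1 cphi).
by rewrite !exprS (chM cphi) IH.
Qed.

End Basics.

Variable N : B -> R.
Hypothesis cN : complete_algebra_norm N.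
Let sN : submult_seminorm N := can_sn cN.

Lemma half_series_eq0 x C : (forall n, N x <= C * 2^-1 ^+ n) -> x = 0.
Proof.
move=> /le0_half_expr Nx; apply: (can_eq0 cN).
by apply/eqP; rewrite eq_le Nx (sn_ge0 sN).
Qed.

Lemma neumann x : N x <= 2^-1 -> exists y, (1 - x) * y = 1.
Proof.
move=> Nx; have Nxn n : N (x ^+ n.+1) <= 2^-1 ^+ n.+1.
  elim: n => [|n IH]; first by rewrite !expr1.
  rewrite exprS (exprS 2^-1); apply: le_trans (snM sN _ _) _.
  by rewrite ler_pM// (sn_ge0 sN).
have h0 n : 0 <= (2^-1 : R) ^+ n by rewrite exprn_ge0// invr_ge0.
have hS n : (2^-1 : R) ^+ n.+1 <= 2^-1 ^+ n.
  by rewrite exprS; have := h0 n; lra.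
have [s hs] := can_lim cN (fun n => le_trans (Nxn n) (hS n)).
(* The inverse is the geometric series. Its term [1] stays outside the sum because [N 1] may exceed
   the bound [1] that [can_lim] asks of the first term. *)
exists (1 + s); apply/eqP; rewrite -subr_eq0; apply/eqP.
apply: (@half_series_eq0 _ 4) => n.
have e : \sum_(i < n) x ^+ i.+1 - x - x * \sum_(i < n) x ^+ i.+1 = - x ^+ n.+1.
  elim: n => [|n IH]; first by rewrite big_ord0; ring.
  rewrite !big_ord_recr /= mulrDr !opprD -exprS.
  have -> a b c d f : a + b + c + (d + f) = a + c + d + (b + f) :> B by ring.
  by rewrite IH; ring.
have := hs n; move: e; set t := \sum_(i < n) _ => e hn.
have -> : (1 - x) * (1 + s) - 1 = (s - t) - (x * (s - t) + x ^+ n.+1).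
  by rewrite -[x ^+ _]opprK -e; ring.
apply: le_trans (snB sN _ _) _; have := snD sN (x * (s - t)) (x ^+ n.+1).
have h1 := Nxn n; have h2 := hS n; have h3 := snM sN x (s - t).
have : N x * N (s - t) <= 2^-1 * N (s - t) by rewrite ler_wpM2r// (sn_ge0 sN).
by have := h0 n; lra.
Qed.

(** If [phi x] were larger, [1 - (phi x)^-1 *: x] would be invertible by [neumann], yet [phi] sends
    it to [0]. *)
Lemma character_bounded phi x : character phi -> nc (phi x) <= 2 * N x.
Proof.
move=> cphi; rewrite leNgt; apply/negP => lt.
have px : 0 < nc (phi x) by rewrite (le_lt_trans _ lt)// mulr_ge0// (sn_ge0 sN).
have px0 : phi x != 0 by rewrite -normc_gt0.
have [|y] := @neumann ((phi x)^-1 *: x).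
  by rewrite (snZ sN) normc_inv ler_pdivrMl//; lra.
move=> /(congr1 phi); rewrite (chM cphi) (chB cphi) (ch1 cphi) (chZ cphi).
by rewrite mulVf// subrr mul0r => /esym/eqP; rewrite oner_eq0.
Qed.

(* The quotient seminorm [q x = inf_b N (x + u b)] dominates a multiplicative
   seminorm, whose kernel is the kernel of a character. *)
Theorem gelfand u : (forall y, u * y <> 1) ->
  exists2 phi, character phi & phi u = 0.
Proof.
move=> nu.
pose S x s := exists b, s = N (x + u * b).
have S0 x : exists s, S x s by exists (N (x + u * 0)), 0.
have Sge x s : S x s -> 0 <= s by move=> [b ->]; exact: sn_ge0.
pose q x := inf [set s | S x s].
have sq : submult_seminorm q.
  apply: inf_bounds_seminorm => //.
  - move=> k x _ [b ->]; exists (k *: b).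
    by rewrite -(snZ sN) scalerDr scalerAr.
  - move=> x y _ _ [b ->] [c ->]; exists (N (x + y + u * (b + c))).
      by exists (b + c).
    have -> : x + y + u * (b + c) = (x + u * b) + (y + u * c) by ring.
    exact: snD.
  - move=> x y _ _ [b ->] [c ->].
    exists (N (x * y + u * (x * c + y * b + u * b * c))).
      by exists (x * c + y * b + u * b * c).
    have -> : x * y + u * (x * c + y * b + u * b * c) = (x + u * b) * (y + u * c) by ring.
    exact: snM.
have q1 : 1 <= q 1.
  (* If [N (1 + u * b)] were below one half, [neumann] would make [u] invertible. The bound one half
     then rises to [1] by submultiplicativity. *)
  apply: (sn1_ge1 sq); apply: (@lt_le_trans _ _ 2^-1); first by rewrite invr_gt0.
  apply: inf_bounds_ge => // _ [b ->]; rewrite leNgt; apply/negP => /ltW/neumann[y].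
  have -> : (1 - (1 + u * b)) * y = u * (- (b * y)) by ring.
  exact: nu.
have [p mp pq] := exists_minimal_seminorm sq q1.
have sp : submult_seminorm p by case: mp.
have pu : p u = 0.
  apply/eqP; rewrite eq_le (sn_ge0 sp) andbT (le_trans (pq u))//.
  rewrite -(sn0 sN); apply: inf_bounds_le => //; exists (-1).
  by rewrite mulrN1 subrr.
have [phi hphi] := choice (minimal_eigenvalue mp).
(* The scalar at [p]-distance [0] from [x] is unique, which forces [phi] to respect the algebra
   operations. *)
have uniq x k l : p (x - k%:A) = 0 -> p (x - l%:A) = 0 -> k = l.
  move=> hk hl; apply/eqP; rewrite -subr_eq0 -normc_eq0 -(minimal_scalar mp).
  rewrite eq_le (sn_ge0 sp) andbT.
  have -> : (k - l)%:A = (x - l%:A) - (x - k%:A) :> B by rewrite scalerBl; ring.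
  by apply: le_trans (snB sp _ _) _; rewrite hk hl addr0.
have zeroD x y : p x = 0 -> p y = 0 -> p (x + y) = 0.
  move=> x0 y0; apply/eqP; rewrite eq_le (sn_ge0 sp) andbT.
  by apply: le_trans (snD sp _ _) _; rewrite x0 y0 addr0.
have zeroM x y : p x = 0 -> p (x * y) = 0.
  by move=> x0; rewrite (minimalM mp) x0 mul0r.
exists phi; first split.
- by apply: (uniq 1); [exact: hphi|rewrite scale1r subrr (sn0 sp)].
- move=> x y; apply: (uniq (x * y)); first exact: hphi.
  have -> : x * y - (phi x * phi y)%:A = (x - (phi x)%:A) * y + (y - (phi y)%:A) * (phi x)%:A.
    by rewrite -scalerA -(mulr_algl _ (phi y)%:A); ring.
  by apply: zeroD; exact: zeroM.
- move=> x y; apply: (uniq (x + y)); first exact: hphi.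
  have -> : x + y - (phi x + phi y)%:A = (x - (phi x)%:A) + (y - (phi y)%:A).
    by rewrite scalerDl; ring.
  exact: zeroD.
- move=> k x; apply: (uniq (k *: x)); first exact: hphi.
  by rewrite -scalerA -scalerBr (snZ sp) hphi mulr0.
- by apply: (uniq u); [exact: hphi|rewrite scale0r subr0].
Qed.

End Characters.

(** * Gliding hump: [phi \o D] is unbounded for only finitely many characters *)

Record algebra_derivation (R : realType) (B : comAlgType R[i]) (D : B -> B) : Prop :=
  AlgebraDerivation {
    derD : forall x y, D (x + y) = D x + D y;
    derZ : forall (k : R[i]) x, D (k *: x) = k *: D x;
    derM : forall x y, D (x * y) = D x * y + x * D y }.

Section GlidingHump.
Variables (R : realType) (B : comAlgType R[i]) (N : B -> R) (D : B -> B).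
Hypothesis cN : complete_algebra_norm N.
Hypothesis dD : algebra_derivation D.
Implicit Types (x y z h s P : B) (phi psi : B -> R[i]).

Local Notation nc := (@ComplexField.Normc.normc R).
Let sN : submult_seminorm N := can_sn cN.

(** Every tail of the series is a multiple of the product of the squares [h j ^+ 2]. Squares are
    taken because a derivation sends a multiple of [h n ^+ 2] to a multiple of [h n]. *)
Lemma gliding_series (h y : nat -> B) :
  (forall n, N (h n) <= 1) -> (forall n, N (y n) <= 2^-1 ^+ n) ->
  exists x, forall n, exists z,
    x = \sum_(i < n) (\prod_(j < i) h j ^+ 2) * y i + (\prod_(j < n) h j ^+ 2) * z.
Proof.
move=> hh hy.
pose Q n k := \prod_(j < k) h (n + j)%N ^+ 2.
pose u n k := Q n k * y (n + k)%N.
have QN n k z : N (Q n k * z) <= N z.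
  rewrite /Q; elim: k z => [|k IH] z; first by rewrite big_ord0 mul1r.
  rewrite big_ord_recr /= -mulrA; apply: le_trans (IH _) _.
  rewrite expr2 -mulrA; have nh w : N (h (n + k)%N * w) <= N w.
    by apply: le_trans (snM sN _ _) _; rewrite ler_piMl// (sn_ge0 sN).
  exact: le_trans (nh _) (nh _).
have half_le n k : (2^-1 : R) ^+ (n + k) <= 2^-1 ^+ k.
  by rewrite exprD ler_piMl ?exprn_ge0 ?invr_ge0// exprn_ile1 ?invr_ge0// invf_le1// ler1n.
have uN n k : N (u n k) <= 2^-1 ^+ k.
  exact: le_trans (QN _ _ _) (le_trans (hy _) (half_le _ _)).
have [z hz] := choice (fun n => can_lim cN (uN n)).
have PQ n k : \prod_(j < n + k) h j ^+ 2 = (\prod_(j < n) h j ^+ 2) * Q n k.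
  elim: k => [|k IH]; first by rewrite addn0 /Q big_ord0 mulr1.
  by rewrite addnS /Q !big_ord_recr /= IH mulrA.
pose s n := \sum_(i < n) (\prod_(j < i) h j ^+ 2) * y i.
have sE n k : s (n + k)%N = s n + (\prod_(j < n) h j ^+ 2) * \sum_(i < k) u n i.
  elim: k => [|k IH]; first by rewrite addn0 big_ord0 mulr0 addr0.
  by rewrite addnS /s !big_ord_recr /= -/(s _) IH PQ mulrDr addrA mulrA.
(* The identity holds for partial sums and passes to the limits, the error being a multiple of
   [2^-1 ^+ k] for every [k]. *)
exists (z 0%N) => n; exists (z n); apply/eqP; rewrite -subr_eq0; apply/eqP.
set P := \prod_(j < n) _.
apply: (@half_series_eq0 _ _ _ cN _ (2 + 2 * N P)) => k.
have hn := hz n k; have h0 := hz 0%N (n + k)%N.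
have s0 m : \sum_(i < m) u 0%N i = s m by [].
rewrite s0 sE -/P in h0.
have -> : z 0%N - (s n + P * z n) =
    (z 0%N - (s n + P * \sum_(i < k) u n i)) - P * (z n - \sum_(i < k) u n i) by ring.
apply: le_trans (snB sN _ _) _; rewrite mulrDl.
have := snM sN P (z n - \sum_(i < k) u n i).
have := ler_wpM2l (sn_ge0 sN P) hn; have := half_le n k; lra.
Qed.

Definition unbounded_at phi :=
  character phi /\ forall K, exists2 x, N x <= 1 & K < nc (phi (D x)).

(** By the Leibniz rule [phi P * phi (D y)] can be made to dominate the other terms: [y] is a small
    multiple of a vector of the unit ball at which [phi \o D] is as large as desired. *)
Lemma hump phi P s (n : nat) : unbounded_at phi -> phi P != 0 ->
  exists2 y, N y <= 2^-1 ^+ n & n%:R <= nc (phi (D (s + P * y))).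
Proof.
move=> [cphi ub] P0.
have t0 : 0 < (2^-1 : R) ^+ n by rewrite exprn_gt0// invr_gt0.
set t := 2^-1 ^+ n in t0 *.
(* [K] is solved from the target [n%:R] plus the two terms to be beaten; the factor [2] bounds [phi]
   on the unit ball. *)
pose K := (n%:R + nc (phi (D s)) + nc (phi (D P)) * 2) / (t * nc (phi P)).
have [x Nx Kx] := ub K; exists (t%:C%C *: x).
  by rewrite (snZ sN) normc_real ?(ltW t0)// ler_piMr// ltW.
have t1 : t <= 1 by rewrite exprn_ile1 ?invr_ge0// invf_le1// ler1n.
have : n%:R + nc (phi (D s)) + nc (phi (D P)) * 2 <= t * nc (phi P) * nc (phi (D x)).
  by rewrite -ler_pdivrMl ?mulr_gt0 ?normc_gt0// mulrC ltW.
have -> : t * nc (phi P) * nc (phi (D x)) = nc (phi P * phi (D (t%:C%C *: x))).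
  rewrite (derZ dD) (chZ cphi) !normc_mul normc_real ?(ltW t0)//; ring.
have e : phi P * phi (D (t%:C%C *: x)) = phi (D (s + P * (t%:C%C *: x))) +
    - (phi (D s)) - phi (D P) * phi (t%:C%C *: x).
  rewrite (derD dD) (derM dD) !(chD cphi) !(chM cphi); ring.
rewrite e.
have h1 := normc_triangle (phi (D (s + P * (t%:C%C *: x))) + - (phi (D s)))
  (- (phi (D P) * phi (t%:C%C *: x))).
have h2 := normc_triangle (phi (D (s + P * (t%:C%C *: x)))) (- (phi (D s))).
rewrite !normc_opp in h1 h2.
have h3 : nc (phi (D P) * phi (t%:C%C *: x)) <= nc (phi (D P)) * 2.
  rewrite normc_mul ler_wpM2l ?normc_ge0//.
  apply: le_trans (character_bounded cN _ cphi) _.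
  rewrite (snZ sN) normc_real ?(ltW t0)//.
  have : t * N x <= 1 by rewrite mulr_ile1 ?(sn_ge0 sN)// ltW.
  lra.
lra.
Qed.

(** Take [h] with values [0] and [1] at two members. No character kills both [h] and [1 - h], so one
    of these is nonzero at infinitely many members. *)
Lemma split_infinite (Phi : set (B -> R[i])) : infinite_set Phi ->
  (forall phi, Phi phi -> character phi) ->
  exists phi h, [/\ Phi phi, N h <= 1, phi h = 0 &
    infinite_set [set psi | Phi psi /\ psi h != 0]].
Proof.
move=> infPhi cPhi.
(* Rescaling [h] brings its norm below [1] without changing where characters vanish on it. *)
suff [phi [h [Pphi ph inf]]] : exists phi h, [/\ Phi phi, phi h = 0 &
    infinite_set [set psi | Phi psi /\ psi h != 0]].
  pose k : R[i] := ((1 + N h)^-1)%:C%C.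
  have Nh1 : 0 < 1 + N h by have := sn_ge0 sN h; lra.
  have nk : nc k = (1 + N h)^-1 by rewrite normc_real// invr_ge0 ltW.
  exists phi, (k *: h); split => //.
  - by rewrite (snZ sN) nk ler_pdivrMl//; lra.
  - by rewrite (chZ (cPhi _ Pphi)) ph mulr0.
  - apply: sub_infinite_set inf => psi [Ppsi psih]; split => //.
    by rewrite (chZ (cPhi _ Ppsi)) mulf_neq0// -normc_gt0 nk invr_gt0.
have [phi1 P1] := infinite_setN0 infPhi.
have [phi2 [P2 ne]] := infinite_setN0 (infinite_setD infPhi (finite_set1 phi1)).
have [x hx] : exists x, phi2 x != phi1 x.
  apply: contrapT => H; apply: ne; apply: funext => x.
  by apply: contrapT => /eqP hx; apply: H; exists x.
pose h := (phi2 x - phi1 x)^-1 *: (x - (phi1 x)%:A).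
have h1 : phi1 h = 0.
  by have c := cPhi _ P1; rewrite (chZ c) (chB c) (ch_scalar c) subrr mulr0.
have h2 : phi2 (1 - h) = 0.
  have c := cPhi _ P2; rewrite (chB c) (ch1 c) (chZ c) (chB c) (ch_scalar c).
  by rewrite mulVf ?subr_eq0// subrr.
have [fin|] := pselect (finite_set [set psi | Phi psi /\ psi h != 0]); last first.
  by exists phi1, h.
exists phi2, (1 - h); split => //.
move=> fin'; apply: infPhi.
apply: sub_finite_set (_ : _ `<=` [set psi | Phi psi /\ psi h != 0] `|`
  [set psi | Phi psi /\ psi (1 - h) != 0]) _; last by rewrite finite_setU.
move=> psi Ppsi; have [e|] := eqVneq (psi h) 0; last by left.
by right; split => //; have c := cPhi _ Ppsi; rewrite (chB c) (ch1 c) e subr0 oner_eq0.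
Qed.

(** The state iterated by dependent choice: the stage, the characters still available, the product
    of squares and the partial sum. The invariant [phi hs_P != 0] is what [hump] needs at the next
    stage. *)
Record hump_state := HumpState {
  hs_n : nat; hs_set : set (B -> R[i]); hs_P : B; hs_s : B;
  hs_inf : infinite_set hs_set;
  hs_unb : forall phi, hs_set phi -> unbounded_at phi /\ phi hs_P != 0 }.

Lemma hump_step (st : hump_state) : exists st' : hump_state, exists phi h y,
  [/\ [/\ hs_n st' = (hs_n st).+1, hs_P st' = hs_P st * h ^+ 2 &
        hs_s st' = hs_s st + hs_P st * y], 
      [/\ character phi, phi h = 0, N h <= 1 & N y <= 2^-1 ^+ hs_n st] &
      (hs_n st)%:R <= nc (phi (D (hs_s st + hs_P st * y)))].
Proof.
case: st => n Phi P s inf unb /=.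
have [phi [h [Pphi Nh ph inf']]] :=
  split_infinite inf (fun phi Pphi => proj1 (proj1 (unb phi Pphi))).
have [uphi phiP] := unb _ Pphi.
have [y Ny hy] := @hump phi P s n uphi phiP.
have unb' psi : Phi psi /\ psi h != 0 -> unbounded_at psi /\ psi (P * h ^+ 2) != 0.
  move=> [Ppsi psih]; have [upsi psiP] := unb _ Ppsi; split => //.
  by rewrite (chM (proj1 upsi)) (chX (proj1 upsi)) mulf_neq0// expf_neq0.
by exists (HumpState n.+1 (s + P * y) inf' unb'), phi, h, y; split => //; split => //; case: uphi.
Qed.

(** Otherwise one [x] satisfies [n%:R <= nc (phi (D x))] for each [n] and some character [phi]
    depending on [n], while [character_bounded] caps these values by [2 * N (D x)]. *)
Theorem finite_unbounded : finite_set unbounded_at.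
Proof.
apply: contrapT => inf.
have unb phi : unbounded_at phi -> unbounded_at phi /\ phi 1 != 0.
  by move=> u; split => //; rewrite (ch1 (proj1 u)) oner_eq0.
have [f [f0 fS]] := dependent_choice (fun st => cid (hump_step st)) (HumpState 0 0 inf unb).
have [phi fS1] := choice fS; have [h fS2] := choice fS1; have [y {fS fS1}fS] := choice fS2.
have fn n : hs_n (f n) = n.
  by elim: n => [|n IH]; [rewrite f0|case: (fS n) => -[-> _ _]; rewrite IH].
have fP n : hs_P (f n) = \prod_(j < n) h j ^+ 2.
  elim: n => [|n IH]; first by rewrite f0 big_ord0.
  by rewrite big_ord_recr /= -IH; case: (fS n) => -[_ -> _].
have fs n : hs_s (f n) = \sum_(i < n) (\prod_(j < i) h j ^+ 2) * y i.
  elim: n => [|n IH]; first by rewrite f0 big_ord0.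
  by rewrite big_ord_recr /= -IH -fP; case: (fS n) => -[_ _ ->].
have [|n|x hx] := @gliding_series h y.
- by move=> n; case: (fS n) => _ [].
- by case: (fS n) => _ [_ _ _]; rewrite fn.
have key n : n%:R <= 2 * N (D x).
  have [_ [c ph _ _]] := fS n; rewrite fn fP fs.
  have [z ->] := hx n.+1; move=> /le_trans; apply.
  apply: le_trans (character_bounded cN _ c); rewrite !big_ord_recr /=.
  set P := \prod_(j < n) _; set s := \sum_(i < n) _.
  (* The tail contains [h n] twice, so each term of its derivative keeps a factor [h n] and is
     killed by [phi]. *)
  have -> : s + P * y n + P * h n ^+ 2 * z = (s + P * y n) + h n * (h n * (P * z)) by ring.
  by rewrite (derD dD (s + _)) (derM dD (h n)) !(chD c) !(chM c) ph !mul0r mulr0 !addr0.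
have := archi_boundP (sn_ge0 sN (D x)).
set m := Num.bound _ => hm.
have := key (m * 2)%N; rewrite natrM; lra.
Qed.

End GlidingHump.

(** * The closed graph theorem, by way of Baire's argument *)

Section ClosedGraph.
Variables (R : realType) (B : comAlgType R[i]) (N : B -> R) (T : B -> B).
Hypothesis cN : complete_algebra_norm N.
Hypothesis TD : forall x y, T (x + y) = T x + T y.
Hypothesis TZ : forall (k : R[i]) x, T (k *: x) = k *: T x.
Implicit Types (x y z : B).

Let sN : submult_seminorm N := can_sn cN.
Let Nge0 := sn_ge0 sN.

Let T0 : T 0 = 0. Proof. by have := TZ 0 0; rewrite !scale0r. Qed.
Let TB x y : T (x - y) = T x - T y.
Proof. by rewrite TD -[- y]scaleN1r TZ scaleN1r. Qed.

Let NZr (t : R) x : 0 <= t -> N (t%:C%C *: x) = t * N x.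
Proof. by move=> t0; rewrite (snZ sN) normc_real. Qed.

(** Otherwise a shrinking sequence of balls avoids the sets [N (T z) <= k] one after another, and at
    the limit of the centres [N (T z)] exceeds every integer. *)
Lemma baire_bounded : exists k a r, [/\ 0 < r, 0 <= k &
  forall y, N (y - a) <= r -> forall e, 0 < e ->
    exists2 z, N (y - z) <= e & N (T z) <= k].
Proof.
apply: contrapT => H.
(* A state is a bound, a centre and a radius. The ball of twice the new radius must avoid the set,
   since later centres can drift that far. *)
have step (st : nat * B * {r : R | 0 < r}) : exists st' : nat * B * {r : R | 0 < r},
    [/\ st'.1.1 = st.1.1.+1, N (st'.1.2 - st.1.2) <= sval st.2,
      sval st'.2 <= sval st.2 / 2 &
      forall z, N (st'.1.2 - z) <= 2 * sval st'.2 -> st.1.1%:R < N (T z)].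
  case: st => -[k a] [r r0] /=; apply: contrapT => H'; apply: H.
  exists k%:R, a, r; split => // y ya e e0; apply: contrapT => H2; apply: H'.
  have m0 : 0 < Num.min e r / 2 by rewrite divr_gt0// lt_min e0.
  exists (k.+1, y, exist _ (Num.min e r / 2) m0); split => //=.
    by rewrite ler_pM2r ?invr_gt0// ge_min lexx orbT.
  move=> z yz; rewrite ltNge; apply/negP => Tz; apply: H2; exists z => //.
  by apply: le_trans yz _; rewrite mulrC divfK// ge_min lexx.
have [f [f0 fS]] := dependent_choice (fun st => cid (step st)) (0%N, 0, exist _ 1 ltr01).
pose a n := (f n).1.2; pose r n := sval (f n).2.
have fn n : (f n).1.1 = n.
  by elim: n => [|n IH]; [rewrite f0|case: (fS n) => ->; rewrite IH].
have r0 n : 0 < r n by exact: (svalP (f n).2).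
have rS n : r n.+1 <= r n / 2 by case: (fS n).
have r2 n : r n <= 2^-1 ^+ n.
  elim: n => [|n IH]; first by rewrite /r f0 expr0.
  by rewrite exprS; have := rS n; lra.
have aS n : N (a n.+1 - a n) <= r n by case: (fS n).
have dist k n : N (a (k + n)%N - a k) <= 2 * r k - 2 * r (k + n)%N.
  elim: n => [|n IH]; first by rewrite addn0 !subrr (sn0 sN).
  rewrite addnS.
  have -> : a (k + n).+1 - a k = (a (k + n).+1 - a (k + n)%N) + (a (k + n)%N - a k) by ring.
  apply: le_trans (snD sN _ _) _; have := aS (k + n)%N; have := rS (k + n)%N; lra.
have [x hx] := can_lim cN (fun n => le_trans (aS n) (r2 n)).
have hx' n : N (x + a 0%N - a n) <= 2 * 2^-1 ^+ n.
  have := hx n; rewrite -(big_mkord xpredT (fun i => a i.+1 - a i)) telescope_sumr//.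
  by rewrite opprB addrA.
have xa k : N (a k.+1 - (x + a 0%N)) <= 2 * r k.+1.
  rewrite (sn_subC sN) -subr_le0; apply: (@le0_half_expr _ _ 2) => n.
  have := hx' (k.+1 + n)%N; have := dist k.+1 n.
  have -> : x + a 0%N - a k.+1 = (x + a 0%N - a (k.+1 + n)%N) + (a (k.+1 + n)%N - a k.+1) by ring.
  have := snD sN (x + a 0%N - a (k.+1 + n)%N) (a (k.+1 + n)%N - a k.+1).
  have : (2^-1 : R) ^+ (k.+1 + n) <= 2^-1 ^+ n.
    by rewrite exprD ler_piMl ?exprn_ge0 ?invr_ge0// exprn_ile1 ?invr_ge0// invf_le1// ler1n.
  have := r0 (k.+1 + n)%N; lra.
have key k : k%:R < N (T (x + a 0%N)) by have [_ _ _] := fS k; rewrite fn; apply; exact: xa.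
have := archi_boundP (Nge0 (T (x + a 0%N))); set m := Num.bound _ => hm.
by have := lt_trans hm (key m); rewrite ltxx.
Qed.

(** After scaling, [y] is the difference of two points of the ball from [baire_bounded], and the
    difference of their approximants serves for it. *)
Lemma approx_bounded : exists2 K, 0 < K &
  forall y, exists2 z, N (y - z) <= N y / 2 & N (T z) <= K * N y.
Proof.
have [k [a [r [r0 k0 H]]]] := baire_bounded.
exists (2 * k / r + 1); first by have : 0 <= 2 * k / r; [rewrite divr_ge0 ?mulr_ge0// ltW|lra].
move=> y; have := Nge0 y; rewrite le_eqVlt => /predU1P[Ny|Ny].
  by exists 0; rewrite ?subr0 ?T0 ?(sn0 sN) -?Ny ?mul0r ?mulr0// (can_eq0 cN (esym Ny)) (sn0 sN).
pose t := r / N y; have t0 : 0 < t by rewrite divr_gt0.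
(* Two errors of [r / 4] add up to [r / 2], which becomes [N y / 2] after division by [t]. *)
have r4 : 0 < r / 4 by lra.
have [|z1 hz1 Tz1] := H (a + t%:C%C *: y) _ _ r4.
  by rewrite [a + _]addrC addrK NZr ?(ltW t0)// /t divfK// gt_eqF.
have [|z2 hz2 Tz2] := H a _ _ r4; first by rewrite subrr (sn0 sN) ltW.
have ti0 : 0 <= t^-1 by rewrite invr_ge0 ltW.
have ey : y = (t^-1)%:C%C *: (t%:C%C *: y).
  by rewrite scalerA -rmorphM mulVf ?gt_eqF// scale1r.
exists ((t^-1)%:C%C *: (z1 - z2)).
  rewrite {1}ey -scalerBr NZr// mulrC ler_pdivrMr//.
  have -> : N y / 2 * t = r / 2 by rewrite /t; field; rewrite gt_eqF.
  have -> : t%:C%C *: y - (z1 - z2) = (a + t%:C%C *: y - z1) - (a - z2) by ring.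
  apply: le_trans (snB sN _ _) _; lra.
rewrite TZ NZr// TB.
have : t^-1 * N (T z1 - T z2) <= t^-1 * (2 * k).
  rewrite ler_wpM2l//; apply: le_trans (snB sN _ _) _; lra.
have -> : t^-1 * (2 * k) = 2 * k / r * N y by rewrite /t invf_div; ring.
lra.
Qed.

(** The hypothesis says that the separating space of [T] is zero. Successive approximation makes the
    images [T (Z (v n))] summable, with sum [w]; since [v n] tends to [0] and [T (v n)] to
    [T y - w], the latter is separating, hence zero. *)
Theorem closed_graph :
  (forall s, (forall e, 0 < e -> exists2 a, N a <= e & N (T a - s) <= e) -> s = 0) ->
  exists2 K, 0 <= K & forall x, N (T x) <= K * N x.
Proof.
move=> closed; have [K K0 H] := approx_bounded.
have [Z hZ] : {Z : B -> B & forall y, N (y - Z y) <= N y / 2 /\ N (T (Z y)) <= K * N y}.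
  apply: (@choice _ _ (fun y z => N (y - z) <= N y / 2 /\ N (T z) <= K * N y)).
  by move=> y; have [z] := H y; exists z.
(* This normalization puts the images below [2^-1 ^+ n], as [can_lim] requires. *)
have unit_case y : K * N y <= 1 -> N (T y) <= 2.
  move=> Ky; pose v n := iter n (fun w => w - Z w) y.
  have vN n : N (v n) <= N y * 2^-1 ^+ n.
    elim: n => [|n IH]; first by rewrite expr0 mulr1.
    rewrite exprS /=; have [h _] := hZ (v n); apply: le_trans h _.
    rewrite -/(v n); lra.
  have uN n : N (T (Z (v n))) <= 2^-1 ^+ n.
    have [_ h] := hZ (v n); apply: le_trans h _.
    apply: le_trans (_ : K * (N y * 2^-1 ^+ n) <= _); first by rewrite ler_pM2l.
    by rewrite mulrA ler_piMl// exprn_ge0// invr_ge0.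
  have [w hw] := can_lim cN uN.
  have Tv n : T (v n) = T y - \sum_(i < n) T (Z (v i)).
    elim: n => [|n IH]; first by rewrite big_ord0 subr0.
    by rewrite big_ord_recr /= TB -/(v n) IH; ring.
  suff : T y - w = 0.
    by move=> /eqP; rewrite subr_eq0 => /eqP ->; have := hw 0%N; rewrite big_ord0 subr0 expr0 mulr1.
  apply: closed => e e0.
  have pos : 0 < e / (2 + N y) by rewrite divr_gt0//; have := Nge0 y; lra.
  have [n hn] := half_expr_small pos.
  have {}hn : 2^-1 ^+ n * (2 + N y) <= e.
    by rewrite -ler_pdivlMr ?ltW//; have := Nge0 y; lra.
  have h0 : 0 <= (2^-1 : R) ^+ n by rewrite exprn_ge0// invr_ge0.
  have h1 : 0 <= (2^-1 : R) ^+ n * N y by rewrite mulr_ge0.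
  exists (v n); first by apply: le_trans (vN n) _; lra.
  have -> : T (v n) - (T y - w) = w - \sum_(i < n) T (Z (v i)) by rewrite Tv; ring.
  apply: le_trans (hw n) _; lra.
exists (2 * K) => [|x]; first by rewrite mulr_ge0// ltW.
have := Nge0 x; rewrite le_eqVlt => /predU1P[Nx|Nx].
  by rewrite (can_eq0 cN (esym Nx)) T0 (sn0 sN) mulr0.
have KN : 0 < K * N x by rewrite mulr_gt0.
have := unit_case ((K * N x)^-1%:C%C *: x).
rewrite TZ !NZr ?invr_ge0 ?(ltW KN)// => h.
rewrite -mulrA -ler_pdivrMr// mulrC; apply: h.
by rewrite mulrCA mulVf// gt_eqF.
Qed.

End ClosedGraph.

(** * Derivations of commutative semisimple Banach algebras vanish *)

Section Johnson.
Variables (R : realType) (B : comAlgType R[i]) (N : B -> R) (D : B -> B).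
Hypothesis cN : complete_algebra_norm N.
Hypothesis dD : algebra_derivation D.
Hypothesis semisimple :
  forall x : B, (forall phi, character phi -> phi x = 0) -> x = 0.
Implicit Types (x y z : B) (phi psi : B -> R[i]).

Local Notation nc := (@ComplexField.Normc.normc R).
Let sN : submult_seminorm N := can_sn cN.
Let Nge0 := sn_ge0 sN.

Let D0 : D 0 = 0. Proof. by have := derZ dD 0 0; rewrite !scale0r. Qed.

Lemma derivation1 : D 1 = 0.
Proof.
have := derM dD 1 1; rewrite !mulr1 mul1r => e.
by apply: (addrI (D 1)); rewrite addr0.
Qed.

Lemma derB x y : D (x - y) = D x - D y.
Proof. by rewrite (derD dD) -[- y]scaleN1r (derZ dD) scaleN1r. Qed.

Lemma der_scalar (k : R[i]) : D k%:A = 0.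
Proof. by rewrite (derZ dD) derivation1 scaler0. Qed.

(** [g] is a product of Lagrange factors [(phi0 x - phi x)^-1 *: (x - (phi x)%:A)], with [x]
    separating [phi] from [phi0]. *)
Lemma prime_avoidance phi0 (s : seq (B -> R[i])) : character phi0 ->
  (forall phi, phi \in s -> character phi) ->
  exists2 g, phi0 g = 1 & forall phi, phi \in s -> phi != phi0 -> phi g = 0.
Proof.
move=> c0; elim: s => [|phi s IH] cs; first by exists 1; rewrite ?(ch1 c0).
have [|g g0 gs] := IH; first by move=> psi ps; apply: cs; rewrite inE ps orbT.
have cphi : character phi by apply: cs; rewrite mem_head.
have [->|ne] := eqVneq phi phi0.
  by exists g => // psi; rewrite inE => /predU1P[->|]; [rewrite eqxx|exact: gs].
have [x hx] : exists x, phi0 x != phi x.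
  apply: contrapT => H; move/eqP: ne; apply; apply: funext => x.
  by apply: contrapT => /eqP hx; apply: H; exists x; rewrite eq_sym.
exists (g * ((phi0 x - phi x)^-1 *: (x - (phi x)%:A))).
  rewrite (chM c0) g0 mul1r (chZ c0) (chB c0) (ch_scalar c0).
  by rewrite mulVf// subr_eq0.
move=> psi; rewrite inE => /predU1P[-> _|ps psi0].
  by rewrite (chM cphi) (chZ cphi) (chB cphi) (ch_scalar cphi) subrr !mulr0.
have cpsi : character psi by apply: cs; rewrite inE ps orbT.
by rewrite (chM cpsi) gs// mul0r.
Qed.

(* An element [t] seen by [phi0] only satisfies [t (x - phi0 x) = 0]; applying
   [phi0 \o D] to this identity gives [phi0 (D x) = 0]. *)
Lemma isolated_character phi0 t : character phi0 -> phi0 t != 0 ->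
  (forall phi, character phi -> phi != phi0 -> phi t = 0) ->
  forall x, phi0 (D x) = 0.
Proof.
move=> c0 t0 ht x; pose y := x - (phi0 x)%:A.
have y0 : phi0 y = 0 by rewrite (chB c0) (ch_scalar c0) subrr.
have ty : t * y = 0.
  apply: semisimple => phi cphi; rewrite (chM cphi).
  by have [->|ne] := eqVneq phi phi0; [rewrite y0 mulr0|rewrite ht// mul0r].
have := congr1 phi0 (congr1 D ty).
rewrite (derM dD) (chD c0) !(chM c0) y0 mulr0 add0r D0 (ch0 c0) => /eqP.
by rewrite mulf_eq0 (negbTE t0) /= derB der_scalar subr0 => /eqP.
Qed.

(** Characters with [phi \o D] bounded kill [s], so only finitely many see it. If [phi0] does,
    [g * s] with [g] from [prime_avoidance] is seen by [phi0] alone, and [isolated_character] gives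
    [phi0 \o D = 0], which is not unbounded. *)
Lemma derivation_closed s :
  (forall e, 0 < e -> exists2 a, N a <= e & N (D a - s) <= e) -> s = 0.
Proof.
move=> hs; have [L FL] := (finite_seqP _).1 (finite_unbounded cN dD).
have cL phi : phi \in L -> unbounded_at N D phi.
  by move=> pL; have : [set` L] phi by []; rewrite -FL.
have bounded phi : character phi -> phi \notin L -> phi s = 0.
  move=> c /negP nL.
  have [K hK] : exists K, forall x, N x <= 1 -> nc (phi (D x)) <= K.
    apply: contrapT => H; apply: nL.
    have : [set` L] phi; last by [].
    rewrite -FL; split => // K; apply: contrapT => H'; apply: H; exists K => x Nx.
    by rewrite leNgt; apply/negP => Kx; apply: H'; exists x.
  have K0 : 0 <= K by apply: le_trans (hK 0 _); rewrite ?normc_ge0 ?(sn0 sN).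
  apply/eqP; rewrite -normc_eq0 eq_le normc_ge0 andbT.
  apply: (@le0_half_expr _ _ (2 + K)) => n.
  have h0 : 0 < (2^-1 : R) ^+ n by rewrite exprn_gt0// invr_gt0.
  have [a Na Da] := hs _ h0; set t := 2^-1 ^+ n in h0 Na Da *.
  have ha : nc (phi (D a)) <= K * t.
    have := hK ((t^-1)%:C%C *: a).
    rewrite (snZ sN) normc_real ?invr_ge0 ?(ltW h0)// (derZ dD) (chZ c) normc_mul.
    rewrite normc_real ?invr_ge0 ?(ltW h0)// => h.
    by rewrite -ler_pdivrMr// mulrC; apply: h; rewrite ler_pdivrMl// mulr1.
  have hb := character_bounded cN (D a - s) c.
  have := normc_triangle (phi (D a)) (- phi (D a - s)).
  rewrite normc_opp {1}(chB c) opprB addrC subrK; lra.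
apply: semisimple => phi0 c0; apply: contrapT => /eqP s0.
have L0 : phi0 \in L by apply: contraNT s0 => /(bounded _ c0)/eqP.
have [g g0 gL] := prime_avoidance c0 (fun phi pL => proj1 (cL phi pL)).
have D0' := @isolated_character phi0 (g * s) c0.
have [_ ub] := cL _ L0; have [x _] := ub 0; rewrite D0' ?normc_0 ?ltxx//.
  by rewrite (chM c0) g0 mul1r.
move=> phi c ne; rewrite (chM c).
by have [pL|pL] := boolP (phi \in L); [rewrite gL// mul0r|rewrite bounded// mulr0].
Qed.


Lemma iterD_add k x y : iter k D (x + y) = iter k D x + iter k D y.
Proof. by elim: k => //= k ->; rewrite (derD dD). Qed.

(** The spare factor [w] makes the formula iterable: both terms are again a power of [a] times an
    element. *)
Lemma derivation_expr a n w :
  D (a ^+ n.+1 * w) = a ^+ n * (D a * w *+ n.+1) + a ^+ n.+1 * D w.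
Proof.
rewrite (derM dD); congr (_ + _).
elim: n => [|n IH] in w *; first by rewrite expr1 expr0 mul1r mulr1n.
rewrite exprS (derM dD) mulrDl -[a * _ * _]mulrA IH [in RHS]mulrSr.
by rewrite mulrDr addrC [a * (_ * _)]mulrA -exprS; congr (_ + _); rewrite mulrAC mulrC.
Qed.

(** Each [D] lowers the exponent of [a] by at most one, so a factor [a] remains for [phi] to
    kill. *)
Lemma iter_derivation_lt phi a k n w : character phi -> phi a = 0 ->
  (k < n)%N -> phi (iter k D (a ^+ n * w)) = 0.
Proof.
move=> c a0; elim: k n w => [|k IH] [|n] w // kn.
  by rewrite /= (chM c) (chX c) a0 expr0n mul0r.
rewrite iterSr derivation_expr iterD_add (chD c) !IH ?addr0//.
exact: ltnW.
Qed.

(** Only the branch in which every [D] falls on the power of [a] survives [phi]; the successive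
    exponents multiply to the factorial. *)
Lemma iter_derivation_eq phi a n w : character phi -> phi a = 0 ->
  phi (iter n D (a ^+ n * w)) = n`!%:R * phi (D a) ^+ n * phi w.
Proof.
move=> c a0; elim: n w => [|n IH] w; first by rewrite !expr0 /= !mul1r.
rewrite iterSr derivation_expr iterD_add (chD c) IH iter_derivation_lt// addr0.
rewrite -(scaler_nat _ (D a * w)) (chZ c) (chM c) factS natrM exprS.
by move: (n.+1%:R) (n`!%:R) (phi (D a) ^+ n) => u v t; ring.
Qed.

(** The quotients of [T ^+ n] by the factorials are the terms of the exponential series, hence tend
    to [0]. *)
Lemma factorial_not_geometric (C T : R) : ~ forall n, n`!%:R <= C * T ^+ n.
Proof.
move=> H.
have C0 : 0 < C by have := H 0%N; rewrite fact0 expr0 mulr1; exact: lt_le_trans.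
have C0' : 0 < C^-1 by rewrite invr_gt0.
have /cvgrPdist_lt/(_ _ C0')[n _ /(_ n (leqnn n))/=] :=
  cvg_series_cvg_0 (is_cvg_series_exp_coeff T).
rewrite sub0r normrN => /(le_lt_trans (ler_norm _)); rewrite /exp_coeff /=.
have f0 : 0 < (n`!%:R : R) by rewrite ltr0n fact_gt0.
rewrite ltr_pdivrMr// ltr_pdivlMl// => /(le_lt_trans (H n)).
by rewrite ltxx.
Qed.

(* Comparing [n! (phi (D a))^n = phi (D^n (a^n))], valid when [phi a = 0], with
   the bound [O (K^n)] coming from the continuity of [D]. *)
Theorem singer_wermer_johnson phi x : character phi -> phi (D x) = 0.
Proof.
move=> c.
have [K K0 hK] := closed_graph cN (derD dD) (derZ dD) derivation_closed.
pose a := x - (phi x)%:A.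
have a0 : phi a = 0 by rewrite (chB c) (ch_scalar c) subrr.
suff : phi (D a) = 0 by rewrite derB der_scalar subr0.
apply: contrapT => /eqP; rewrite -normc_gt0 => t0.
apply: (@factorial_not_geometric (2 * N 1) (K * N a / nc (phi (D a)))) => n.
have iterK y : N (iter n D y) <= K ^+ n * N y.
  elim: n => [|n IH]; first by rewrite expr0 mul1r.
  by rewrite /= exprS -mulrA; apply: le_trans (hK _) _; rewrite ler_wpM2l.
have := character_bounded cN (iter n D (a ^+ n * 1)) c.
rewrite (iter_derivation_eq n 1 c a0) (ch1 c) !mulr1 normc_mul normcX normc_natr => h.
rewrite expr_div_n mulrA ler_pdivlMr ?exprn_gt0//; apply: le_trans h _.
rewrite -mulrA ler_pM2l// exprMn mulrCA; apply: le_trans (iterK _) _.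
by rewrite ler_wpM2l ?exprn_ge0//; exact: snX.
Qed.

End Johnson.

(** * The norm of [A] as a real number, and completeness for geometric series *)

Section RealNorm.
Variables (R : realType) (A : completeNormedModType R[i]).
Implicit Types (x y : A).

Local Notation nc := (@ComplexField.Normc.normc R).

(** The norm takes values in [R[i]]; being nonnegative it is real, so its real part loses
    nothing. *)
Definition real_norm x : R := complex.Re `|x|.

Lemma real_normE x : `|x| = (real_norm x)%:C%C.
Proof. by rewrite /real_norm RRe_real// ger0_real. Qed.

Lemma real_norm_eq0 x : real_norm x = 0 -> x = 0.
Proof. by move=> x0; apply/normr0_eq0; rewrite real_normE x0. Qed.

Lemma real_norm0 : real_norm 0 = 0.
Proof. by rewrite /real_norm normr0. Qed.

Lemma real_norm_ge0 x : 0 <= real_norm x.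
Proof. by have := normr_ge0 x; rewrite real_normE lecR. Qed.

Lemma real_normD x y : real_norm (x + y) <= real_norm x + real_norm y.
Proof. by have := ler_normD x y; rewrite !real_normE -rmorphD lecR. Qed.

Lemma real_normN x : real_norm (- x) = real_norm x.
Proof. by rewrite /real_norm normrN. Qed.

Lemma real_normZ k x : real_norm (k *: x) = nc k * real_norm x.
Proof.
have := normrZ k x; rewrite norm_normc !real_normE -rmorphM.
by move/(congr1 (@complex.Re R)).
Qed.

Lemma real_norm_complete (u : nat -> A) :
  (forall n, real_norm (u n) <= 2^-1 ^+ n) ->
  exists l, forall n, real_norm (l - \sum_(i < n) u i) <= 2 * 2^-1 ^+ n.
Proof.
move=> hu; pose S n := \sum_(i < n) u i.
have h0 n : 0 <= (2^-1 : R) ^+ n by rewrite exprn_ge0// invr_ge0.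
have tail n k : real_norm (S (n + k)%N - S n) <= 2 * 2^-1 ^+ n.
  apply: le_trans (_ : 2 * 2^-1 ^+ n - 2 * 2^-1 ^+ (n + k) <= _); last by have := h0 (n + k)%N; lra.
  elim: k => [|k IH]; first by rewrite addn0 !subrr real_norm0.
  rewrite addnS /S big_ord_recr /= -/(S _) addrAC.
  apply: le_trans (real_normD _ _) _; have := hu (n + k)%N; rewrite exprS; lra.
have tail_le n m : (n <= m)%N -> real_norm (S m - S n) <= 2 * 2^-1 ^+ n.
  by move=> /subnKC <-; exact: tail.
have posC (z : R[i]) : 0 < z -> 0 < complex.Re z /\ z = (complex.Re z)%:C%C.
  move=> z0; have e : z = (complex.Re z)%:C%C by rewrite RRe_real// gtr0_real.
  by split => //; move: z0; rewrite {1}e ltcR.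
have cS : cauchy (S @ \oo).
  apply: cauchy_exP => z /posC[z0 ze]; rewrite ze.
  move: (complex.Re z) z0 => e e0 {z ze}.
  have e2 : 0 < e / 2 by lra.
  have [n hn] := half_expr_small e2.
  exists (S n); exists n => // m nm; rewrite -ball_normE /=.
  rewrite real_normE ltcR -real_normN opprB (le_lt_trans (tail_le _ _ nm))//; lra.
have lS : S @ \oo --> lim (S @ \oo) by exact: cauchy_cvg cS.
set l := lim _ in lS.
exists l => n; rewrite -subr_le0; apply: (@le0_half_expr _ _ 1) => j.
have hj : 0 < (((2^-1 : R) ^+ j)%:C)%C by rewrite ltcR exprn_gt0// invr_gt0.
have /cvgrPdist_lt/(_ _ hj)[m _ hm] := lS.
have := hm (maxn m n) (leq_maxl m n); rewrite /= real_normE ltcR => h1.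
have h2 := tail_le n (maxn m n) (leq_maxr m n).
have -> : l - \sum_(i < n) u i = (l - S (maxn m n)) + (S (maxn m n) - S n).
  by rewrite addrA subrK.
have := real_normD (l - S (maxn m n)) (S (maxn m n) - S n); lra.
Qed.

End RealNorm.

(** * The corner [e A], its characters, and the spectrum in [A] *)

Section Corner.
Variables (R : realType) (A : completeNormedModType R[i]) (mul : A -> A -> A).
Variable e : A.
Hypothesis ba : banach_algebra_mul mul.
Hypothesis rad_rann : jacobson_radical mul = rann mul.
Hypothesis comm_rad : quotient_by_rad_commutative mul.
Hypothesis mule : forall a, mul a e = a.
Hypothesis e_neq0 : e != 0.

Local Notation nc := (@ComplexField.Normc.normc R).
Local Notation "x ** y" := (mul x y) (at level 40, left associativity).

Let mA a b c : a ** (b ** c) = a ** b ** c. Proof. by case: ba. Qed.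
Let mDl a b c : (a + b) ** c = a ** c + b ** c. Proof. by case: ba => _ []. Qed.
Let mDr a b c : a ** (b + c) = a ** b + a ** c. Proof. by case: ba => _ []. Qed.
Let mZl k a b : (k *: a) ** b = k *: (a ** b). Proof. by case: ba => _ []. Qed.
Let mZr k a b : a ** (k *: b) = k *: (a ** b). Proof. by case: ba => _ []. Qed.
Let mNl a b : (- a) ** b = - (a ** b).
Proof. by rewrite -scaleN1r mZl scaleN1r. Qed.
Let mNr a b : a ** (- b) = - (a ** b).
Proof. by rewrite -scaleN1r mZr scaleN1r. Qed.
Let m0r a : a ** 0 = 0.
Proof. by have := mZr 0 a 0; rewrite !scale0r. Qed.

Lemma real_normM a b : real_norm (a ** b) <= real_norm a * real_norm b.
Proof.
have : `|a ** b| <= `|a| * `|b| by case: ba => _ [].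
by rewrite !real_normE -rmorphM lecR.
Qed.

(** Writing [a] as [a ** e] gives [a ** c = a ** (e ** c)]. *)
Lemma rannP c : rann mul c <-> e ** c = 0.
Proof.
split=> [|ec a]; first exact.
by rewrite -[a]mule -mA ec m0r.
Qed.

Lemma mulC_mod a b : e ** (a ** b) = e ** (b ** a).
Proof.
have : rann mul (a ** b - b ** a) by rewrite -rad_rann; exact: comm_rad.
by move=> /rannP/eqP; rewrite mDr mNr subr_eq0 => /eqP.
Qed.

Definition in_corner : pred A := fun x => e ** x == x.

Lemma in_corner_closed : GRing.subsemimod_closed in_corner.
Proof.
split; first split.
- by apply/eqP; exact: m0r.
- by move=> x y /eqP hx /eqP hy; apply/eqP; rewrite mDr hx hy.
- by move=> k x /eqP hx; apply/eqP; rewrite mZr hx.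
Qed.

(* The corner [e A] is a complement of [rann A]: it realises the quotient
   [A / rad A] as a closed subalgebra, which is commutative with unit [e]. *)
Definition corner := {x : A | in_corner x}.

HB.instance Definition _ := SubChoice.copy corner {x : A | in_corner x}.
HB.instance Definition _ :=
  GRing.SubChoice_isSubLmodule.Build R[i] A in_corner corner in_corner_closed.

Lemma cornerP (x : corner) : e ** val x = val x.
Proof. exact/eqP/(valP x). Qed.

Lemma val_cornerD (x y : corner) : val (x + y) = val x + val y.
Proof. exact: raddfD. Qed.

Lemma val_cornerB (x y : corner) : val (x - y) = val x - val y.
Proof. exact: raddfB. Qed.

Lemma val_cornerZ k (x : corner) : val (k *: x) = k *: val x.
Proof. exact: linearZ. Qed.

Lemma to_corner_proof (a : A) : in_corner (e ** a).
Proof. by apply/eqP; rewrite mA mule. Qed.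

Definition to_corner (a : A) : corner := Sub (e ** a) (to_corner_proof a).

(** The product already lies in the corner; the projection only supplies membership and reduces
    commutativity to [mulC_mod]. *)
Definition corner_mul (x y : corner) := to_corner (val x ** val y).

Lemma val_corner_mul x y : val (corner_mul x y) = val x ** val y.
Proof. by rewrite /= mA cornerP. Qed.

Fact corner_mulA : associative corner_mul.
Proof. by move=> x y z; apply/val_inj; rewrite !val_corner_mul mA. Qed.

Fact corner_mulC : commutative corner_mul.
Proof. by move=> x y; apply/val_inj; exact: mulC_mod. Qed.

Fact corner_mul1 : left_id (to_corner e) corner_mul.
Proof. by move=> x; apply/val_inj; rewrite val_corner_mul /= mule cornerP. Qed.

Fact corner_mulD : left_distributive corner_mul +%R.
Proof. by move=> x y z; apply/val_inj; rewrite val_cornerD !val_corner_mul val_cornerD mDl. Qed.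

Fact corner_nz : to_corner e != 0.
Proof. by apply/eqP => /(congr1 val) /=; rewrite mule; exact/eqP. Qed.

HB.instance Definition _ := GRing.Zmodule_isComNzRing.Build corner
  corner_mulA corner_mulC corner_mul1 corner_mulD corner_nz.

Fact corner_scaleAl (k : R[i]) (x y : corner) : k *: (x * y) = (k *: x) * y.
Proof. by apply/val_inj; rewrite val_cornerZ !val_corner_mul val_cornerZ mZl. Qed.

HB.instance Definition _ := GRing.Lmodule_isLalgebra.Build R[i] corner corner_scaleAl.
HB.instance Definition _ := GRing.Lalgebra_isComAlgebra.Build R[i] corner.

Lemma val_cornerM (x y : corner) : val (x * y) = val x ** val y.
Proof. exact: val_corner_mul. Qed.

Lemma val_corner1 : val (1 : corner) = e.
Proof. exact: mule. Qed.

Lemma to_cornerD a b : to_corner (a + b) = to_corner a + to_corner b.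
Proof. by apply/val_inj; rewrite val_cornerD /= mDr. Qed.

Lemma to_cornerZ k a : to_corner (k *: a) = k *: to_corner a.
Proof. by apply/val_inj; rewrite val_cornerZ /= mZr. Qed.

(** The inner [e] is absorbed on the right of [a]. Thus [to_corner] is an algebra morphism, with
    kernel [rann mul] by [rannP]. *)
Lemma to_cornerM a b : to_corner (a ** b) = to_corner a * to_corner b.
Proof. by apply/val_inj; rewrite val_cornerM /= !mA mule. Qed.

Lemma to_cornerB a b : to_corner (a - b) = to_corner a - to_corner b.
Proof. by rewrite to_cornerD -scaleN1r to_cornerZ scaleN1r. Qed.

Lemma to_cornerK (x : corner) : to_corner (val x) = x.
Proof. by apply/val_inj; rewrite /= cornerP. Qed.

Definition corner_norm (x : corner) : R := real_norm (val x).

Lemma corner_norm_complete : complete_algebra_norm corner_norm.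
Proof.
split.
- split=> [k x|x y|x y]; rewrite /corner_norm.
  + by rewrite val_cornerZ real_normZ.
  + by rewrite val_cornerD real_normD.
  + by rewrite val_cornerM real_normM.
- by move=> x /real_norm_eq0 x0; apply/val_inj; rewrite x0.
- move=> u hu; have [l hl] := real_norm_complete hu.
  have sumE n : val (\sum_(i < n) u i) = \sum_(i < n) val (u i).
    exact: (big_morph _ val_cornerD).
  (* Left multiplication by [e] is continuous, so the limit stays in the corner. *)
  have el : e ** l = l.
    apply/eqP; rewrite -subr_eq0; apply/eqP/real_norm_eq0/eqP.
    rewrite eq_le real_norm_ge0 andbT.
    apply: (@le0_half_expr _ _ (2 * real_norm e + 2)) => n.
    set s := \sum_(i < n) val (u i).
    have -> : e ** l - l = e ** (l - s) - (l - s).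
      have es : e ** s = s by rewrite /s -sumE cornerP.
      by rewrite mDr mNr es opprB addrA addrNK.
    apply: le_trans (real_normD _ _) _; rewrite real_normN.
    have := real_normM e (l - s); have := ler_wpM2l (real_norm_ge0 e) (hl n).
    by have := hl n; rewrite -/s; lra.
  exists (to_corner l) => n; rewrite /corner_norm.
  by rewrite val_cornerB /= el sumE; exact: hl.
Qed.

(* With [z] the inverse of [1 - v] modulo [rann A], the quasi-inverse is [- v z]. *)
Lemma corner_quasi_invertible v :
  (exists z, (1 - to_corner v) * z = 1) -> quasi_invertible mul v.
Proof.
move=> [z hz].
have h1 : v ** val z - v ** (v ** val z) = v.
  have := congr1 val hz; rewrite mulrBl mul1r => h.
  have {}h : val z - e ** v ** val z = e.
    by rewrite -[RHS]val_corner1 -h val_cornerB val_cornerM.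
  by rewrite -[RHS]mule -[in RHS]h mDr mNr !mA mule.
have h2 : v ** val z - v ** val z ** v = v.
  have := congr1 val hz; rewrite mulrC mulrBr mulr1 => h.
  have {}h : val z - val z ** v = e.
    by rewrite -[RHS]val_corner1 -h val_cornerB val_cornerM /= mA mule.
  by rewrite -[RHS]mule -[in RHS]h mDr mNr !mA.
exists (- (v ** val z)); split.
- by rewrite mNr opprK -[v in v - _]h1 addrAC addrNK subrr.
- by rewrite mNl opprK -[X in _ + X + _]h2 addrA addNr add0r addNr.
Qed.

(** If all characters kill [x], they send each [1 - x * b] to [1], so [gelfand] makes it invertible.
    Hence [x] lies in the radical, that is in [rann mul], which meets the corner only in [0]. *)
Lemma corner_semisimple (x : corner) :
  (forall phi, character phi -> phi x = 0) -> x = 0.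
Proof.
move=> hx; have : rann mul (val x).
  rewrite -rad_rann => b; apply: corner_quasi_invertible; apply: contrapT => H.
  have [|phi c] := @gelfand _ _ _ corner_norm_complete (1 - to_corner (val x ** b)).
    by move=> z hz; apply: H; exists z.
  rewrite (chB c) (ch1 c) to_cornerM to_cornerK (chM c) hx// mul0r subr0 => /eqP.
  by rewrite oner_eq0.
by move=> /rannP; rewrite cornerP => x0; apply/val_inj; rewrite x0.
Qed.

Lemma spectrum_character a l : spectrum mul a l -> l != 0 ->
  exists2 phi, character phi & phi (to_corner a) = l.
Proof.
move=> [->|nq l0]; first by rewrite eqxx.
have [|phi c] := @gelfand _ _ _ corner_norm_complete (1 - to_corner (l^-1 *: a)).
  by move=> z hz; apply: nq; apply: corner_quasi_invertible; exists z.
rewrite (chB c) (ch1 c) to_cornerZ (chZ c) => /eqP; rewrite subr_eq0 => /eqP h.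
by exists phi => //; apply: (mulfI (invr_neq0 l0)); rewrite -h mulVf.
Qed.

(** For [l != 0], [phi] takes the value [1] at [l^-1 *: a], and applying it to the quasi-inverse
    equation yields [1 = 0]. *)
Lemma character_spectrum phi a : character phi -> spectrum mul a (phi (to_corner a)).
Proof.
move=> c; set l := phi _; have [|l0] := eqVneq l 0; [by left|right].
case=> y [h _]; have := congr1 (phi \o to_corner) h; rewrite /=.
rewrite to_cornerB to_cornerD to_cornerM (chB c) (chD c) (chM c) to_cornerZ (chZ c).
rewrite -/l mulVf// mul1r addrK -(scale0r a) to_cornerZ (chZ c) mul0r.
by move=> /eqP; rewrite oner_eq0.
Qed.

Lemma spectral_radius_ge a l : spectrum mul a l -> nc l <= spectral_radius mul a.
Proof.
move=> al; apply: ub_le_sup; last by exists l.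
(* The supremum is meaningful only once the spectrum is known to be bounded; boundedness of
   characters provides this. *)
exists (2 * corner_norm (to_corner a)) => _ [k ak <-].
have [->|k0] := eqVneq k 0; first by rewrite normc_0 mulr_ge0// real_norm_ge0.
have [phi c <-] := spectrum_character ak k0.
exact: (character_bounded corner_norm_complete (to_corner a) c).
Qed.

Lemma spectral_radius_le a r : 0 <= r ->
  (forall phi, character phi -> nc (phi (to_corner a)) <= r) ->
  spectral_radius mul a <= r.
Proof.
move=> r0 H; apply: ge_sup; first by exists (nc 0), 0 => //; left.
move=> _ [k ak <-]; have [->|k0] := eqVneq k 0; first by rewrite normc_0.
by have [phi c <-] := spectrum_character ak k0; exact: H.
Qed.

(** If [e ** x = 0], then [x] is in [rann mul] and [d (e ** x) = d e ** x + e ** d x] reduces to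
    [e ** d x = 0]. So [d] descends to a derivation [D] of the corner, to which
    [singer_wermer_johnson] applies. *)
Lemma character_derivation phi d a : derivation mul d -> character phi ->
  phi (to_corner (d a)) = 0.
Proof.
move=> [dlin dM] c.
have dD x y : d (x + y) = d x + d y by have := dlin 1 x y; rewrite !scale1r.
have d0 : d 0 = 0 by apply: (addrI (d 0)); rewrite -dD !addr0.
have dZ k x : d (k *: x) = k *: d x by rewrite -[k *: x]addr0 dlin d0 addr0.
have d_rann x : e ** x = 0 -> e ** d x = 0.
  move=> ex; have := dM e x; rewrite ex d0.
  by have /rannP := ex => /(_ (d e)) ->; rewrite add0r.
pose D (x : corner) := to_corner (d (val x)).
have dD' : algebra_derivation D.
  split=> [x y|k x|x y]; rewrite /D.
  - by rewrite val_cornerD dD to_cornerD.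
  - by rewrite val_cornerZ dZ to_cornerZ.
  - by rewrite val_cornerM dM to_cornerD !to_cornerM !to_cornerK.
(* [a - e ** a] is killed by [e] on the left, and [d_rann] carries this over to its image under
   [d]. *)
have -> : to_corner (d a) = D (to_corner a).
  apply/val_inj/eqP; rewrite -subr_eq0; apply/eqP => /=.
  rewrite -mNr -mDr -scaleN1r -dZ -dD; apply: d_rann.
  by rewrite scaleN1r mDr mNr mA mule subrr.
exact: singer_wermer_johnson corner_norm_complete dD' corner_semisimple _ _ c.
Qed.

Lemma generalized_derivation_bounded delta : generalized_derivation mul delta ->
  spectrally_bounded mul delta.
Proof.
move=> [dlin [d [dd dM]]]; split => //.
exists (2 * corner_norm (to_corner (delta e))); split.
  by rewrite mulr_ge0// real_norm_ge0.
move=> a; have r0 : 0 <= spectral_radius mul a.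
  by have := @spectral_radius_ge a 0; rewrite normc_0; apply; left.
apply: spectral_radius_le => [|phi c]; first by rewrite mulr_ge0// mulr_ge0// real_norm_ge0.
(* Expanding [delta (a ** e)] gives [a ** delta e + d a], and [phi] kills the part coming from
   [d a]. *)
rewrite -[a in delta a]mule dM mule to_cornerD to_cornerM (chD c) (chM c).
rewrite (character_derivation _ dd c) addr0 normc_mul mulrC ler_pM ?normc_ge0//.
  exact: (character_bounded corner_norm_complete (to_corner (delta e)) c).
exact/spectral_radius_ge/character_spectrum.
Qed.

End Corner.

Unset Implicit Arguments.

Theorem theorem3p4 (R : realType) (A : completeNormedModType R[i])
    (mul : A -> A -> A) :
  banach_algebra_mul mul ->
  jacobson_radical mul = rann mul ->
  quotient_by_rad_commutative mul ->
  has_right_identity mul ->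
  forall delta : A -> A, generalized_derivation mul delta ->
    spectrally_bounded mul delta.
Proof.
move=> ba rad_rann comm_rad [e mule] delta gd.
(* The corner is a nonzero ring only for [e != 0]; if [e = 0], then [mul a e = a] collapses [A] to
   zero. *)
have [e0|e_neq0] := eqVneq e 0; last first.
  exact: (generalized_derivation_bounded ba rad_rann comm_rad mule e_neq0 gd).
have A0 (a : A) : a = 0.
  have [_ [_ _ _ mZr _]] := ba.
  by rewrite -(mule a) e0; have := mZr 0 a 0; rewrite !scale0r.
case: gd => dlin _; split=> //; exists 1; split=> // a.
by rewrite (A0 (delta a)) (A0 a) mul1r.
Qed.
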